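(* Let $\mathcal{T}_h$ be a quasiuniform triangulation of $\Omega\subset\mathbb{R}^d$, and let $(\mathbf{U}^0,\mathbf{V}^0)\in\mathbf{V}_h\times\mathbf{V}_h$ be such that $|\mathbf{U}^0(\mathbf{z})|=1$ and $\langle\mathbf{U}^0(\mathbf{z}),\mathbf{V}^0(\mathbf{z})\rangle=0$ for all $\mathbf{z}\in\mathcal{N}_h$. For $n\ge 0$ (that is, $n=0,\dots,N-1$), and sufficiently small $\tilde C\equiv\tilde C(\Omega,\mathcal{T}_h)>0$, independent of $\tau,h>0$, such that $\tau\le\tilde C h^2$, there exist $\mathbf{U}^{n+1},\mathbf{W}^{n+1}\in\mathbf{V}_h$ which solve the numerical scheme (S) given in the context. Furthermore, $|\mathbf{U}^{n+1}(\mathbf{z})|=1$ for all $\mathbf{z}\in\mathcal{N}_h$, and $$\max_{n=1,\dots,N}\mathcal{E}_h(\mathbf{V}^n,\mathbf{U}^n)+\frac{\tau^2}{2}\sum_{n=1}^N\|d_t\mathbf{V}^n\|_h^2=\mathcal{E}_h(\mathbf{V}^0,\mathbf{U}^0).$$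
   Context: Setting: $T>0$; $\Omega\subset\mathbb{R}^d$, $d\le 3$, is an open, bounded, (convex) polyhedral domain; $\mathcal{T}_h$ is a simplicial partition of $\Omega$ with mesh size $h=\max_{K\in\mathcal{T}_h}\mathrm{diam}(K)$; $V_h\subset H^1(\Omega)$ is the lowest order $H^1$-conforming finite element space, i.e. the space of continuous functions that are affine on each simplex of $\mathcal{T}_h$; $\mathbf{V}_h=[V_h]^3$; $\mathcal{N}_h$ is the set of all vertices of elements of $\mathcal{T}_h$, and $\{\varphi_{\mathbf z}\}_{\mathbf z\in\mathcal{N}_h}$ is the nodal (hat function) basis of $V_h$. $(\cdot,\cdot)$ and $\|\cdot\|$ are the $L^2(\Omega)$ inner product and norm (also for vector- and matrix-valued functions); $\langle\cdot,\cdot\rangle$ is the inner product of $\mathbb{R}^3$. With $\beta_{\mathbf z}=\int_\Omega\varphi_{\mathbf z}\,dx$, the discrete inner product is $(\mathbf v,\mathbf w)_h=\sum_{\mathbf z\in\mathcal{N}_h}\beta_{\mathbf z}\langle\mathbf v(\mathbf z),\mathbf w(\mathbf z)\rangle$, and $\|\mathbf v\|_h^2=(\mathbf v,\mathbf v)_h$. The discrete Laplacian $\Delta_h u\in V_h$ of $u\in H^1(\Omega)$ is defined by $-(\Delta_h u,\varphi_h)_h=(\nabla u,\nabla\varphi_h)$ for all $\varphi_h\in V_h$ (componentwise for vector-valued functions). Time discretization: $\tau=T/N$, $t_n=n\tau$; for a sequence $\{\psi^n\}$, $d_t\psi^n=\tau^{-1}(\psi^n-\psi^{n-1})$ and $\psi^{n+1/2}=\frac12(\psi^{n+1}+\psi^n)$;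 thus $d_t^2\psi^{n+1}=\tau^{-2}(\psi^{n+1}-2\psi^n+\psi^{n-1})$ and $d_t\psi^{n+1/2}=\tau^{-1}(\psi^{n+1/2}-\psi^{n-1/2})$. Scheme (S): given $\mathbf{U}^0,\mathbf{V}^0$, set $\mathbf{U}^{-1}=\mathbf{U}^0-\tau\mathbf{V}^0$ and $\mathbf{W}^0=-\Delta_h\mathbf{U}^0$. For $n=0,\dots,N-1$ determine $\mathbf{U}^{n+1},\mathbf{W}^{n+1}\in\mathbf{V}_h$ such that for all $\mathbf\Phi,\mathbf\Psi\in\mathbf{V}_h$ $$(d_t^2\mathbf{U}^{n+1},\mathbf\Phi)_h+(\nabla\mathbf{W}^{n+1/2},\nabla\mathbf\Phi)=(\lambda_w^{n+1}\mathbf{U}^{n+1/2},\mathbf\Phi)_h,\qquad(\mathbf{W}^{n+1/2},\mathbf\Psi)_h=(\nabla\mathbf{U}^{n+1/2},\nabla\mathbf\Psi),$$ where the discrete Lagrange multiplier $\lambda_w^{n+1}\in V_h$ has the following values at $\mathbf z\in\mathcal{N}_h$: $\lambda_w^{n+1}(\mathbf z)=0$ if $\mathbf{U}^{n+1/2}(\mathbf z)=\mathbf 0$; otherwise, for $n=0$, $$\lambda_w^{1}(\mathbf z)=\frac{\frac12\langle\mathbf{V}^0(\mathbf z),\mathbf{V}^1(\mathbf z)\rangle}{|\mathbf{U}^{1/2}(\mathbf z)|^2}+\frac{(\nabla\mathbf{W}^{1/2},\mathbf{U}^{1/2}(\mathbf z)\otimes\nabla\varphi_{\mathbf z})}{\beta_{\mathbf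 z}|\mathbf{U}^{1/2}(\mathbf z)|^2},$$ and for $n\ge1$, $$\lambda_w^{n+1}(\mathbf z)=-\frac{\langle d_t\mathbf{U}^n(\mathbf z),d_t\mathbf{U}^{n+1/2}(\mathbf z)\rangle}{|\mathbf{U}^{n+1/2}(\mathbf z)|^2}+\frac{(\nabla\mathbf{W}^{n+1/2},\mathbf{U}^{n+1/2}(\mathbf z)\otimes\nabla\varphi_{\mathbf z})}{\beta_{\mathbf z}|\mathbf{U}^{n+1/2}(\mathbf z)|^2}.$$ Here $\mathbf{V}^{n}:=d_t\mathbf{U}^{n}$ for $n\ge1$. Discrete energy: $\mathcal{E}_h(\mathbf{V},\mathbf{U})=\frac12\|\mathbf{V}\|_h^2+\frac12\|\Delta_h\mathbf{U}\|_h^2$.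
   Formalization: The first term of λ_w^1 has a minus sign (with the printed plus, |U^1|=1 fails, e.g. constant U^0⊥V^0≠0). The energy identity with max is replaced by equality at each m=1,…,N with the sum up to m, since the literal max form fails for N≥2. *)

(* Defs.v *)
From HB Require Import structures.
From mathcomp Require Import all_boot all_order all_algebra finmap.
From mathcomp Require Import all_classical all_reals all_analysis.

Set Implicit Arguments.
Unset Strict Implicit.
Unset Printing Implicit Defensive.

Import Order.TTheory GRing.Theory Num.Theory.
Import numFieldNormedType.Exports.

Local Open Scope classical_set_scope.
Local Open Scope ring_scope.

(* The d-dimensional Lebesgue measure, built on [d.-tuple R] (which carries
   the product sigma-algebra) as an iterated product of the Lebesgue measure
   of the line; points of ['rV_d] are reached through [row_of_tuple]. *)
Section cons_measure.
Context {R : realType} {disp : measure_display} {T : measurableType disp}.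
Context {n : nat}.
Variables (m1 : {sigma_finite_measure set T -> \bar R})
  (m2 : {sigma_finite_measure set (n.-tuple T) -> \bar R}).

Definition tuple_cons (p : T * n.-tuple T) : n.+1.-tuple T :=
  [tuple of p.1 :: p.2].

Lemma measurable_tuple_cons : measurable_fun setT tuple_cons.
Proof.
exact: (measurable_cons (f := fst) (g := snd) measurable_fst measurable_snd).
Qed.

Definition cons_measure : set (n.+1.-tuple T) -> \bar R :=
  pushforward (m1 \x m2)%E tuple_cons.

Let cons_measure0 : cons_measure set0 = 0%E.
Proof. rewrite /cons_measure /pushforward preimage_set0; exact: measure0. Qed.

Let cons_measure_ge0 A : (0 <= cons_measure A)%E.
Proof. by rewrite /cons_measure /pushforward; exact: measure_ge0. Qed.

Let mpre (A : set (n.+1.-tuple T)) :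
  measurable A -> measurable (tuple_cons @^-1` A).
Proof.
by move=> mA; rewrite -[X in measurable X]setTI; exact: measurable_tuple_cons.
Qed.

Let cons_measure_sigma_additive : semi_sigma_additive cons_measure.
Proof.
move=> F mF tF mUF; rewrite /cons_measure /pushforward preimage_bigcup.
apply: measure_semi_sigma_additive.
- by move=> k; exact: mpre.
- apply/trivIsetP => /= i j _ _ ij; rewrite -preimage_setI.
  by move/trivIsetP : tF => /(_ _ _ _ _ ij) ->//; rewrite preimage_set0.
- by rewrite -preimage_bigcup; exact: mpre.
Qed.

HB.instance Definition _ := isMeasure.Build _ _ _ cons_measure
  cons_measure0 cons_measure_ge0 cons_measure_sigma_additive.

Let tuple_uncons (t : n.+1.-tuple T) : T * n.-tuple T :=
  (thead t, [tuple of behead t]).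

Let tuple_unconsK (p : T * n.-tuple T) : tuple_uncons (tuple_cons p) = p.
Proof.
by case: p => x t; congr (_, _); apply/val_inj.
Qed.

Let measurable_tuple_uncons : measurable_fun setT tuple_uncons.
Proof.
apply/measurable_fun_pairP; split; last exact: measurable_behead.
by rewrite (_ : _ \o _ = (fun t => tnth t ord0)) //; exact: measurable_tnth.
Qed.

Let cons_measure_sigma_finite : sigma_finite setT cons_measure.
Proof.
have /sigma_finiteP[F [UF ndF Foo]] := sigma_finiteT m1.
have /sigma_finiteP[G [UG ndG Goo]] := sigma_finiteT m2.
exists (fun k => tuple_uncons @^-1` (F k `*` G k)).
  rewrite -preimage_bigcup; apply/seteqP; split => // t _ /=.
  have [i _ Fi] : (\bigcup_i F i) (thead t) by rewrite -UF.
  have [j _ Gj] : (\bigcup_i G i) [tuple of behead t] by rewrite -UG.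
  exists (maxn i j) => //; split => /=.
    by move: Fi; exact/subsetPset/ndF/leq_maxl.
  by move: Gj; exact/subsetPset/ndG/leq_maxr.
move=> k; have [mF Fkoo] := Foo k; have [mG Gkoo] := Goo k; split.
  rewrite -[X in measurable X]setTI; apply: measurable_tuple_uncons => //.
  exact: measurableX.
rewrite /cons_measure /pushforward /=.
rewrite (_ : tuple_cons @^-1` _ = F k `*` G k); last first.
  by rewrite -comp_preimage (_ : _ \o _ = id) //; exact/funext/tuple_unconsK.
by rewrite product_measure1E// lte_mul_pinfty// ge0_fin_numE.
Qed.

HB.instance Definition _ := Measure_isSigmaFinite.Build _ _ _ cons_measure
  cons_measure_sigma_finite.

End cons_measure.

Fixpoint lebesgue_tuple (R : realType) (d : nat) :
    {sigma_finite_measure set (d.-tuple (measurableTypeR R)) -> \bar R} :=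
  match d with
  | 0 => \d_([tuple] : 0.-tuple (measurableTypeR R))
  | d'.+1 => cons_measure (@lebesgue_measure R) (lebesgue_tuple R d')
  end.

Definition row_of_tuple {R : realType} {d : nat}
  (t : d.-tuple (measurableTypeR R)) : 'rV[R]_d := \row_i (tnth t i : R).

Definition integral_on {R : realType} {d : nat} (A : set 'rV[R]_d)
    (f : 'rV[R]_d -> R) : R :=
  \int[lebesgue_tuple R d]_(t in row_of_tuple @^-1` A) f (row_of_tuple t).

(* Euclidean on row vectors, Frobenius on matrices; the library norm of
   matrices is the sup norm. *)
Definition inner {R : realType} {m n : nat} (A B : 'M[R]_(m, n)) : R :=
  \sum_i \sum_j A i j * B i j.

Definition enorm {R : realType} {m n : nat} (A : 'M[R]_(m, n)) : R :=
  Num.sqrt (inner A A).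

Section mesh.
Context {R : realType} {d : nat}.
Implicit Types (K : {fset 'rV[R]_d}) (Th : {fset {fset 'rV[R]_d}}).
Implicit Types Omega : set 'rV[R]_d.

Definition hull K : set 'rV[R]_d :=
  [set x | exists t : 'rV[R]_d -> R,
    [/\ forall z, z \in K -> 0 <= t z, \sum_(z <- K) t z = 1
      & x = \sum_(z <- K) t z *: z]].

Definition affinely_independent K : Prop :=
  forall t : 'rV[R]_d -> R, \sum_(z <- K) t z = 0 ->
    \sum_(z <- K) t z *: z = 0 -> forall z, z \in K -> t z = 0.

Definition polyhedral_domain Omega : Prop :=
  [/\ open Omega, bounded_set Omega, connected Omega & Omega !=set0] /\
  [/\ (closure Omega)^° = Omega &
      exists P : {fset {fset 'rV[R]_d}},
        closure Omega = \bigcup_(K in [set` P]) hull K].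

(* A mesh is the finite set of its d-simplices, each given by its vertices.
   The intersection condition is conformity: two cells meet in the (possibly
   empty) face spanned by their common vertices. *)
Definition triangulation Omega Th : Prop :=
  [/\ forall K, K \in Th -> #|` K| = d.+1 /\ affinely_independent K,
      closure Omega = \bigcup_(K in [set` Th]) hull K &
      forall K K', K \in Th -> K' \in Th ->
        hull K `&` hull K' = hull (K `&` K')%fset].

Definition nodes Th : {fset 'rV[R]_d} := (\bigcup_(K <- Th) K)%fset.

Definition diam (A : set 'rV[R]_d) : R :=
  sup [set enorm (p.1 - p.2) | p in A `*` A].

Definition mesh_size Th : R := \big[Num.max/0]_(K <- Th) diam (hull K).

(* Quasi-uniformity (which includes shape regularity): every cell contains a
   Euclidean ball whose radius is comparable to the global mesh size. *)
Definition quasiuniform (kappa : R) Th : Prop :=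
  forall K, K \in Th -> exists x : 'rV[R]_d,
    [set y | enorm (y - x) <= kappa * mesh_size Th] `<=` hull K.

End mesh.

(* Finite element functions are functions on all of ['rV_d]; only their
   values on [closure Omega] are constrained and used. *)
Section finite_elements.
Context {R : realType} {d : nat}.
Variables (Omega : set 'rV[R]_d) (Th : {fset {fset 'rV[R]_d}}).

Definition Vh (u : 'rV[R]_d -> R) : Prop :=
  {within closure Omega, continuous u} /\
  forall K, K \in Th -> exists (a : 'rV[R]_d) (b : R),
    forall x, hull K x -> u x = inner a x + b.

Definition VVh (u : 'rV[R]_d -> 'rV[R]_3) : Prop :=
  forall k : 'I_3, Vh (fun x => u x 0 k).

Definition hat (z : 'rV[R]_d) : 'rV[R]_d -> R :=
  xget (cst 0) [set phi | Vh phi /\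
    forall y, y \in nodes Th -> phi y = (y == z)%:R].

Definition beta (z : 'rV[R]_d) : R := integral_on Omega (hat z).

Definition hprod_scalar (u v : 'rV[R]_d -> R) : R :=
  \sum_(z <- nodes Th) beta z * (u z * v z).

Definition hprod (u v : 'rV[R]_d -> 'rV[R]_3) : R :=
  \sum_(z <- nodes Th) beta z * inner (u z) (v z).

(* The weak gradient of a function of V_h is represented by its classical
   gradient inside the cells and by 0 on the (null) union of their faces. *)
Definition grad (u : 'rV[R]_d -> R) (x : 'rV[R]_d) : 'rV[R]_d :=
  if `[< exists2 K, K \in Th & (hull K)^° x >]
  then \row_j 'D_(delta_mx 0 j) u x else 0.

Definition vgrad (u : 'rV[R]_d -> 'rV[R]_3) (x : 'rV[R]_d) : 'M[R]_(3, d) :=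
  \matrix_(k, j) grad (fun y => u y 0 k) x 0 j.

Definition L2inner {m n : nat} (F G : 'rV[R]_d -> 'M[R]_(m, n)) : R :=
  integral_on Omega (fun x => inner (F x) (G x)).

Definition dlaplace_scalar (u : 'rV[R]_d -> R) : 'rV[R]_d -> R :=
  xget (cst 0) [set w | Vh w /\ forall phi, Vh phi ->
    - hprod_scalar w phi = L2inner (grad u) (grad phi)].

Definition dlaplace (u : 'rV[R]_d -> 'rV[R]_3) (x : 'rV[R]_d) : 'rV[R]_3 :=
  \row_k dlaplace_scalar (fun y => u y 0 k) x.

Definition energy (v u : 'rV[R]_d -> 'rV[R]_3) : R :=
  2^-1 * hprod v v + 2^-1 * hprod (dlaplace u) (dlaplace u).

End finite_elements.

(* Sequences are indexed by [int] so that the iterate of index -1 is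
   available; [mid u n] is the iterate of index n + 1/2. *)
Section scheme.
Context {R : realType} {d : nat}.
Local Notation field := ('rV[R]_d -> 'rV[R]_3).
Variables (Omega : set 'rV[R]_d) (Th : {fset {fset 'rV[R]_d}}) (tau : R).

Definition dt (u : int -> field) (n : int) : field :=
  fun x => tau^-1 *: (u n x - u (n - 1) x).

Definition mid (u : int -> field) (n : int) : field :=
  fun x => 2^-1 *: (u (n + 1) x + u n x).

Definition velocity (V0 : field) (U : int -> field) (n : int) : field :=
  if n == 0 then V0 else dt U n.

(* The nodal value at z of the multiplier of index n + 1.  The sign of the
   first term for n = 0 is forced by the constraint |U^1(z)| = 1: it gives
   <d_t V^1, U^{1/2}> = - <V^0, V^1> / 2 at z. *)
Definition multiplier (V0 : field) (U W : int -> field) (n : int)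
    (z : 'rV[R]_d) : R :=
  let X := mid U n z in
  if X == 0 then 0 else
  (if n == 0 then - (2^-1 * inner (V0 z) (velocity V0 U 1 z))
   else - inner (dt U n z) (dt (mid U) n z)) / enorm X ^+ 2 +
  L2inner Omega (vgrad Th (mid W n))
    (fun x => X^T *m grad Th (hat Omega Th z) x) /
    (beta Omega Th z * enorm X ^+ 2).

Definition scheme_step (V0 : field) (U W : int -> field)
    (lam : int -> 'rV[R]_d -> R) (n : int) : Prop :=
  [/\ VVh Omega Th (U (n + 1)), VVh Omega Th (W (n + 1)),
      Vh Omega Th (lam (n + 1)) /\
      (forall z, z \in nodes Th -> lam (n + 1) z = multiplier V0 U W n z),
      forall Phi, VVh Omega Th Phi ->
        hprod Omega Th (dt (dt U) (n + 1)) Phi +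
          L2inner Omega (vgrad Th (mid W n)) (vgrad Th Phi) =
        hprod Omega Th (fun x => lam (n + 1) x *: mid U n x) Phi &
      forall Psi, VVh Omega Th Psi ->
        hprod Omega Th (mid W n) Psi =
        L2inner Omega (vgrad Th (mid U n)) (vgrad Th Psi)].

Definition solves_scheme (N : nat) (U0 V0 : field) (U W : int -> field)
    (lam : int -> 'rV[R]_d -> R) : Prop :=
  [/\ U 0 = U0, U (- 1) = (fun x => U0 x - tau *: V0 x),
      W 0 = (fun x => - dlaplace Omega Th U0 x) &
      forall n : nat, (n < N)%N -> scheme_step V0 U W lam n].

End scheme.

(* Main.v *)
Require Import Defs.
From HB Require Import structures.
From mathcomp Require Import all_boot all_order all_algebra finmap.
From mathcomp Require Import all_classical all_reals all_analysis.
From mathcomp Require Import measurable_realfun.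
From mathcomp Require Import ring lra.

Set Implicit Arguments.
Unset Strict Implicit.
Unset Printing Implicit Defensive.

Import Order.TTheory GRing.Theory Num.Theory.
Import numFieldNormedType.Exports.

Local Open Scope classical_set_scope.
Local Open Scope ring_scope.

(** Let A be the opposite of the mass-lumped discrete Laplacian, (A u)(z) =
    (grad u, grad phi_z) / beta_z, acting on nodal values.  With a = U^(n-1),
    b = U^n, b' = U^(n+1) and the midpoint X = (b' + b) / 2, a time step says
    that at every node (b' - 2 b + a) / tau^2 + A (A X) is a multiple of X,
    the multiplier being the one that keeps b' on the sphere.

    Existence.  Multiplying by tau^2 / 2, X has to be parallel to
    q(X) = b + (b - a) / 2 - (tau^2 / 2) A (A X), while |b'| = 1 means that
    <X, X> = <X, b>: so X is the projection of b onto the line spanned by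
    q(X), a fixed point equation.  Two facts make it a contraction in the sup
    norm over the nodes.  First, <b, b + (b - a) / 2> >= 1 whatever
    the velocity: <b - a, b> vanishes at the first
    step because <U^0, V^0> = 0, and equals 1 - <a, b> >= 0 afterwards.  Second,
    the sup norm of A is at most C / h^2 with C depending on d and kappa only,
    so that (tau^2 / 2) A^2 is as small as one likes once tau <= Ctilde h^2.
    Then <b, q> stays above 1/2, X vanishes nowhere, and projection onto a line
    is Lipschitz in its direction (nodal_fixed_point, step_exists).

    The bound on A (lap_bound) compares stiffness with mass.  By
    quasi-uniformity a cell K contains a cube Q of half-side rho = kappa h / d.
    An affine function bounded by M on K has a gradient of l^1 norm at most
    M / rho; a barycentric coordinate decreases from 1 to 0 along an edge of
    length at most h, hence has a gradient of l^1 norm at least 1 / h and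
    exceeds rho / (2 h) on the half-sized cube.  So beta_z is at least a
    constant times h^d for each cell at z, while the stiffness of such a cell
    is at most h^d / h^2 up to a constant; volumes enter only through inscribed
    and circumscribed cubes.  The interiors of the cells are disjoint
    and gradients are constant on them, so the Dirichlet form is a finite sum
    over cells (L2inner_cells).

    The form of the multiplier (multiplierE): testing the equation at a node
    with X, the term <d_t^2 U^(n+1), X> is rewritten with <d_t U^(n+1), X> = 0
    and <d_t U^n, U^(n-1/2)> = 0, or <U^0, V^0> = 0 when n = 0.

    Energy (energy_step): testing with d_t U^(n+1), which is orthogonal to X
    at each node, kills the multiplier; A is symmetric for the lumped product,
    so the second term is the difference of the bending energies, and
    <v' - v, v'> = |v'|^2 / 2 - |v|^2 / 2 + |v' - v|^2 / 2 gives the rest. *)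

(** * The Euclidean inner product *)

Section euclidean.
Context {R : realType} {m n : nat}.
Implicit Types (A B C : 'M[R]_(m, n)) (c : R).

Lemma innerC A B : inner A B = inner B A.
Proof. by apply: eq_bigr => i _; apply: eq_bigr => j _; rewrite mulrC. Qed.

Lemma innerDl A B C : inner (A + B) C = inner A C + inner B C.
Proof.
rewrite /inner -big_split; apply: eq_bigr => i _; rewrite -big_split.
by apply: eq_bigr => j _; rewrite mxE mulrDl.
Qed.

Lemma innerZl c A B : inner (c *: A) B = c * inner A B.
Proof.
rewrite /inner mulr_sumr; apply: eq_bigr => i _; rewrite mulr_sumr.
by apply: eq_bigr => j _; rewrite mxE mulrA.
Qed.

Lemma innerDr A B C : inner C (A + B) = inner C A + inner C B.
Proof. by rewrite innerC innerDl !(innerC C). Qed.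

Lemma innerZr c A B : inner B (c *: A) = c * inner B A.
Proof. by rewrite innerC innerZl (innerC B). Qed.

Lemma innerNl A B : inner (- A) B = - inner A B.
Proof. by rewrite -scaleN1r innerZl mulN1r. Qed.

Lemma innerNr A B : inner B (- A) = - inner B A.
Proof. by rewrite innerC innerNl (innerC B). Qed.

Lemma innerBl A B C : inner (A - B) C = inner A C - inner B C.
Proof. by rewrite innerDl innerNl. Qed.

Lemma innerBr A B C : inner C (A - B) = inner C A - inner C B.
Proof. by rewrite innerDr innerNr. Qed.

Lemma inner0l A : inner 0 A = 0.
Proof. by rewrite -(scale0r 0) innerZl mul0r. Qed.

Lemma inner0r A : inner A 0 = 0.
Proof. by rewrite innerC inner0l. Qed.

Lemma inner_ge0 A : 0 <= inner A A.
Proof. by do 2!(apply: sumr_ge0 => ? _); rewrite -expr2 sqr_ge0. Qed.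

Lemma sqr_entry_le_inner A i j : A i j ^+ 2 <= inner A A.
Proof.
rewrite /inner (bigD1 i)//= (bigD1 j)//= -expr2 -addrA lerDl addr_ge0//.
  by apply: sumr_ge0 => ? _; rewrite -expr2 sqr_ge0.
by do 2!(apply: sumr_ge0 => ? _); rewrite -expr2 sqr_ge0.
Qed.

Lemma enorm_ge0 A : 0 <= enorm A. Proof. exact: sqrtr_ge0. Qed.

Lemma sqr_enorm A : enorm A ^+ 2 = inner A A.
Proof. by rewrite sqr_sqrtr ?inner_ge0. Qed.

Lemma entry_le_enorm A i j : `|A i j| <= enorm A.
Proof. by rewrite -sqrtr_sqr ler_wsqrtr// sqr_entry_le_inner. Qed.

Lemma inner_eq0 A : (inner A A == 0) = (A == 0).
Proof.
apply/eqP/eqP => [AA0|->]; last by rewrite inner0l.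
apply/matrixP => i j; rewrite mxE; apply/eqP; rewrite -sqrf_eq0.
by rewrite eq_le sqr_ge0 andbT -AA0 sqr_entry_le_inner.
Qed.

Lemma enorm_eq1 A : (enorm A = 1) <-> (inner A A = 1).
Proof.
split => [A1|AA1]; first by rewrite -sqr_enorm A1 expr1n.
by rewrite /enorm AA1 sqrtr1.
Qed.

End euclidean.

Section rows.
Context {R : realType}.

Lemma inner_rowE {d : nat} (a x : 'rV[R]_d) : inner a x = \sum_i a 0 i * x 0 i.
Proof. by rewrite /inner big_ord1. Qed.

Lemma inner_le_sum {d : nat} (a x : 'rV[R]_d) (c : R) :
  (forall i, `|x 0 i| <= c) -> `|inner a x| <= c * \sum_i `|a 0 i|.
Proof.
move=> xc; rewrite inner_rowE mulr_sumr (le_trans (ler_norm_sum _ _ _))//.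
by apply: ler_sum => i _; rewrite normrM mulrC ler_wpM2r.
Qed.

Lemma enorm_le_sum {d : nat} (x : 'rV[R]_d) : enorm x <= \sum_i `|x 0 i|.
Proof.
have s0 : 0 <= \sum_i `|x 0 i| by apply: sumr_ge0.
rewrite -[leRHS]ger0_norm// -sqrtr_sqr ler_wsqrtr// inner_rowE expr2 mulr_suml.
apply: ler_sum => i _; rewrite -expr2 -real_normK ?num_real// expr2.
by rewrite ler_wpM2l// (bigD1 i)//= lerDl sumr_ge0.
Qed.

End rows.

(** * Projection of a unit vector onto a line *)

Section sphere.
Context {R : realType}.
Implicit Types u q X : 'rV[R]_3.

Definition line_proj u q : 'rV[R]_3 := (inner u q / inner q q) *: q.

Lemma line_proj_self u q : q != 0 ->
  inner (line_proj u q) (line_proj u q) = inner (line_proj u q) u.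
Proof.
rewrite -inner_eq0 => q0; rewrite /line_proj !innerZl !innerZr (innerC q u).
by field.
Qed.

(** X lies on the sphere having the origin and u as antipodal points, so
    2 X - u is again a unit vector and X is an average of two unit vectors. *)
Lemma sphere_entry_le1 u X k : inner u u = 1 -> inner X X = inner X u ->
  `|X 0 k| <= 1.
Proof.
move=> u1 XXu.
have r1 : inner (2 *: X - u) (2 *: X - u) = 1.
  by rewrite !innerBl !innerBr !innerZl !innerZr u1 (innerC u) XXu; ring.
have Xk : X 0 k = 2^-1 * ((2 *: X - u) 0 k + u 0 k).
  by rewrite !mxE; field.
rewrite Xk normrM ger0_norm ?invr_ge0// -ler_pdivlMl ?invr_gt0// invrK mulr1.
rewrite (le_trans (ler_normD _ _))// -[leRHS]/(1 + 1) lerD//.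
  by rewrite (le_trans (entry_le_enorm _ _ _))// (enorm_eq1 _).2.
by rewrite (le_trans (entry_le_enorm _ _ _))// (enorm_eq1 _).2.
Qed.

Lemma inner3_le u q (a b : R) : (forall k, `|u 0 k| <= a) ->
  (forall k, `|q 0 k| <= b) -> `|inner u q| <= 3 * (a * b).
Proof.
move=> ua qb; apply: (le_trans (inner_le_sum _ qb)).
have b0 : 0 <= b by exact: le_trans (qb 0).
have -> : 3 * (a * b) = b * (3 * a) by ring.
rewrite ler_wpM2l// !big_ord_recl big_ord0 addr0.
by move: (ua 0) (ua (lift ord0 0)) (ua (lift ord0 (lift ord0 0))); lra.
Qed.


Lemma inner_le_enorm3 u q : inner u u = 1 -> `|inner u q| <= 3 * enorm q.
Proof.
move=> u1; rewrite -[enorm q]mul1r; apply: inner3_le => k.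
  by rewrite (le_trans (entry_le_enorm _ _ _))// (enorm_eq1 _).2.
exact: entry_le_enorm.
Qed.

(** Factor |q|^2 - |q'|^2 = <q - q', q + q'> and divide by |q| + |q'|. *)
Lemma enorm_lipschitz q q' (c : R) : (forall k, `|q 0 k - q' 0 k| <= c) ->
  `|enorm q - enorm q'| <= 3 * c.
Proof.
move=> qc; set N := enorm q; set N' := enorm q'.
have c0 : 0 <= c by exact: le_trans (qc 0).
have [N0 N'0] : 0 <= N /\ 0 <= N' by rewrite !enorm_ge0.
have qcE k : `|(q - q') 0 k| <= c by rewrite !mxE.
have key : `|inner (q - q') (q + q')| <= 3 * (c * (N + N')).
  apply: inner3_le => // k; rewrite mxE (le_trans (ler_normD _ _))//.
  by rewrite lerD// entry_le_enorm.
have keyE : inner (q - q') (q + q') = (N - N') * (N + N').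
  rewrite innerBl !innerDr -!sqr_enorm (innerC q' q) -/N -/N'; ring.
move: key; rewrite keyE normrM (ger0_norm (addr_ge0 N0 N'0)).
have [NN'|] := ltP 0 (N + N'); first by rewrite mulrA ler_pM2r.
move=> NN' _; have [-> ->] : N = 0 /\ N' = 0 by split; lra.
by rewrite subrr normr0 mulr_ge0.
Qed.

Lemma line_projE u q : q != 0 ->
  line_proj u q = inner u ((enorm q)^-1 *: q) *: ((enorm q)^-1 *: q).
Proof.
move=> q0; rewrite /line_proj innerZr scalerA -sqr_enorm; congr (_ *: q).
have : enorm q != 0 by rewrite -sqrf_eq0 sqr_enorm inner_eq0.
by move=> ?; field.
Qed.

(** The projection depends on the direction of q only.  As <u, q> >= 1/2 keeps
    |q| away from 0, the normalization q / |q| is Lipschitz even for large q,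
    and line_projE is bilinear in it. *)
Lemma line_proj_lipschitz u q q' (c : R) : inner u u = 1 ->
  2^-1 <= inner u q -> 2^-1 <= inner u q' ->
  (forall k, `|q 0 k - q' 0 k| <= c) ->
  forall k, `|line_proj u q 0 k - line_proj u q' 0 k| <= 144 * c.
Proof.
move=> u1 uq uq' qc.
have c0 : 0 <= c by exact: le_trans (qc 0).
have N_ge p : 2^-1 <= inner u p -> 6^-1 <= enorm p.
  move=> up; have := inner_le_enorm3 p u1.
  by rewrite ger0_norm; [lra|apply: le_trans up; rewrite invr_ge0].
have neq0 p : 2^-1 <= inner u p -> p != 0.
  by apply: contraTneq => ->; rewrite inner0r -ltNge; lra.
have [NN NN'] := (N_ge _ uq, N_ge _ uq').
rewrite !line_projE ?neq0//.
set p := _ *: q; set p' := _ *: q'.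
have unit_le v k : 6^-1 <= enorm v -> `|((enorm v)^-1 *: v) 0 k| <= 1.
  move=> v0; have v0' : 0 < enorm v by lra.
  by rewrite mxE normrM gtr0_norm ?invr_gt0// ler_pdivrMl// mulr1 entry_le_enorm.
have [p1 p'1] : (forall k, `|p 0 k| <= 1) /\ (forall k, `|p' 0 k| <= 1).
  by split=> k; exact: unit_le.
have pp' k : `|p 0 k - p' 0 k| <= 24 * c.
  (* q/N - q'/N' = ((q - q') + (q'/N') (N' - N)) / N *)
  have E : p 0 k - p' 0 k = (enorm q)^-1 *
      ((q 0 k - q' 0 k) + p' 0 k * (enorm q' - enorm q)).
    by rewrite !mxE; field; apply/andP; split; lra.
  have M : `|(q 0 k - q' 0 k) + p' 0 k * (enorm q' - enorm q)| <= c + 1 * (3 * c).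
    rewrite (le_trans (ler_normD _ _))// lerD// normrM ler_pM//.
      by rewrite distrC enorm_lipschitz.
  rewrite E normrM ger0_norm ?invr_ge0 ?enorm_ge0//.
  have -> : 24 * c = 6 * (c + 1 * (3 * c)) by ring.
  apply: ler_pM => //; first by rewrite invr_ge0 enorm_ge0.
  by rewrite -[6]invrK lef_pV2// posrE; lra.
clearbody p p'; have u_le k : `|u 0 k| <= 1.
  by rewrite (le_trans (entry_le_enorm _ _ _))// (enorm_eq1 _).2.
have dot : `|inner u (p - p')| <= 72 * c.
  have -> : 72 * c = 3 * (1 * (24 * c)) by ring.
  by apply: inner3_le => // k; rewrite !mxE.
have dot' : `|inner u p'| <= 3.
  have -> : 3 = 3 * (1 * 1) :> R by ring.
  by apply: inner3_le.
move=> k; rewrite !mxE.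
have -> : inner u p * p 0 k - inner u p' * p' 0 k =
    inner u (p - p') * p 0 k + inner u p' * (p 0 k - p' 0 k).
  by rewrite innerBr; ring.
have -> : 144 * c = 72 * c * 1 + 3 * (24 * c) by ring.
rewrite (le_trans (ler_normD _ _))// !normrM lerD// ler_pM//.
Qed.

End sphere.

(** * The fixed point of one time step *)

(** Matrices are normed and complete; this makes them a complete normed module,
    as the contraction principle requires. *)
HB.instance Definition _ (R : realType) (m n : nat) := Complete.on 'M[R]_(m, n).

Lemma mx_norm_le {R : realType} {m n : nat} (x : 'M[R]_(m, n)) (c : R) :
  0 <= c -> `|x| <= c <-> forall i j, `|x i j| <= c.
Proof.
move=> c0; rewrite [leLHS]mx_normrE; split=> [xc i j|xc].
  apply: le_trans xc; exact: (le_bigmax _ (fun ij => `|x ij.1 ij.2|) (i, j)).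
by apply: bigmax_le => // -[i j] _; exact: xc.
Qed.

(** B stands for (tau^2 / 2) A^2 and p for b + (b - a) / 2.  The Lipschitz
    constant 1/288 is half the inverse of the constant 144 of
    line_proj_lipschitz, so that the composite map contracts by 1/2. *)
Section fixed_point.
Context {R : realType} {T : eqType}.
Variables (s : seq T) (B : (T -> 'rV[R]_3) -> T -> 'rV[R]_3).
Variables (u p : T -> 'rV[R]_3).
Hypothesis B_lipschitz : forall (X Y : T -> 'rV[R]_3) (c : R), 0 <= c ->
  (forall z k, z \in s -> `|X z 0 k - Y z 0 k| <= c) ->
  forall z k, z \in s -> `|B X z 0 k - B Y z 0 k| <= c / 288.
Hypothesis B0 : forall z, z \in s -> B (fun=> 0) z = 0.
Hypothesis u1 : forall z, z \in s -> inner (u z) (u z) = 1.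
Hypothesis up : forall z, z \in s -> 1 <= inner (u z) (p z).

Lemma projected_arg_ge (X : T -> 'rV[R]_3) : (forall z k, z \in s -> `|X z 0 k| <= 1) ->
  forall z, z \in s -> 2^-1 <= inner (u z) (p z - B X z).
Proof.
move=> X1 z zs; rewrite innerBr.
have : `|inner (u z) (B X z)| <= 3 * (1 * (1 / 288)).
  apply: inner3_le => k.
    by rewrite (le_trans (entry_le_enorm _ _ _))// (enorm_eq1 _).2// u1.
  have := @B_lipschitz X (fun=> 0) 1 ler01 _ z k zs; rewrite B0// mxE subr0.
  by apply => w l ws; rewrite mxE subr0 X1.
rewrite ler_norml => /andP[_]; have := up zs; lra.
Qed.

(** Nodal fields are stored in a matrix, one row per node, to work in a complete
    normed space whose norm is the sup norm.  The iteration maps the unit ball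
    to itself because a projection of a unit vector onto a line has norm at
    most 1. *)
Lemma nodal_fixed_point : exists X : T -> 'rV[R]_3, forall z, z \in s ->
  2^-1 <= inner (u z) (p z - B X z) /\ X z = line_proj (u z) (p z - B X z).
Proof.
pose n := size s.
(* One spare row: row n belongs to no node and is sent to 0. *)
pose ext (M : 'M[R]_(n.+1, 3)) (z : T) : 'rV[R]_3 := row (inord (index z s)) M.
pose F (X : T -> 'rV[R]_3) z := line_proj (u z) (p z - B X z).
pose f (M : 'M[R]_(n.+1, 3)) : 'M[R]_(n.+1, 3) :=
  \matrix_(i, k) if ohead (drop i s) is Some z then F (ext M) z 0 k else 0.
pose Ub : set 'M[R]_(n.+1, 3) := [set M | `|M| <= 1].
have headP (i : 'I_n.+1) z : ohead (drop i s) = Some z -> z \in s.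
  by case E : (drop i s) => [//|y l] [<-]; apply: (mem_drop (n0 := i)); rewrite E mem_head.
have ext_le M z k : `|M| <= 1 -> `|ext M z 0 k| <= 1.
  by move=> /mx_norm_le M1; rewrite mxE M1.
have fU : {homo f : M / Ub M >-> Ub M}.
  move=> M /= M1; apply/mx_norm_le => // i k; rewrite mxE.
  case E : (ohead _) => [z|]; last by rewrite normr0.
  have zs := headP _ _ E; apply: (@sphere_entry_le1 _ (u z)); rewrite ?u1//.
  apply: line_proj_self.
  have := projected_arg_ge (fun z k _ => ext_le M z k M1) zs.
  by apply: contraTneq => ->; rewrite inner0r -ltNge; lra.
have ctr : is_contraction (mkfun_fun fU).
  exists (2^-1)%:nng; split => /=; first by lra.
  move=> [M M'] [/= M1 M'1]; apply/mx_norm_le => [|i k]; first exact: mulr_ge0.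
  change (`|(f M - f M') i k| <= 2^-1 * `|M - M'|).
  rewrite mxE [X in _ + X]mxE ![f _ i k]mxE; case E : (ohead _) => [z|]; last first.
    by rewrite subr0 normr0 mulr_ge0.
  have zs := headP _ _ E.
  have -> : 2^-1 * `|M - M'| = 144 * (`|M - M'| / 288) by field.
  apply: line_proj_lipschitz; rewrite ?u1//.
  - exact: (projected_arg_ge (fun z k _ => ext_le M z k M1)).
  - exact: (projected_arg_ge (fun z k _ => ext_le M' z k M'1)).
  - move=> l.
    have -> : (p z - B (ext M) z) 0 l - (p z - B (ext M') z) 0 l =
        - (B (ext M) z 0 l - B (ext M') z 0 l) by rewrite !mxE; ring.
    rewrite normrN; apply: B_lipschitz => // w j _; rewrite !mxE.
    have := (mx_norm_le (M - M') (normr_ge0 _)).1 (lexx _) (inord (index w s)) j.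
    by rewrite !mxE.
have clU : closed Ub.
  rewrite (_ : Ub = (fun M : 'M[R]_(n.+1, 3) => `|M|) @^-1` [set x | x <= 1])//.
  by apply: closed_comp => [M _|]; [exact: norm_continuous|exact: closed_le].
have [|M M1 fM] := banach_fixed_point ctr clU; first by exists 0; rewrite /Ub/= normr0.
exists (ext M) => z zs; split.
  by apply: projected_arg_ge => // w k _; exact: ext_le.
apply/rowP => k; rewrite {1}/ext mxE {1}fM -[mkfun_fun fU M]/(f M) [LHS]mxE inordK; last first.
  by rewrite ltnS ltnW ?index_mem.
by rewrite (drop_nth z) ?index_mem//= nth_index.
Qed.

End fixed_point.

(** * Barycentric coordinates *)

Section simplex.
Context {R : realType} {d : nat}.
Implicit Types (K : {fset 'rV[R]_d}) (v : 'rV[R]_d -> R) (a x y z : 'rV[R]_d).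

Definition is_simplex K := #|` K| = d.+1 /\ affinely_independent K.

(* Homogeneous coordinates turn affine independence into freeness of the rows. *)
Let hmat K : 'M[R]_(#|` K|, d + 1) :=
  \matrix_i row_mx (nth 0 (enum_fset K) i) (const_mx 1).

Let sum_fset K (V : nmodType) (F : 'rV[R]_d -> V) :
  \sum_(z <- K) F z = \sum_(i < #|` K|) F (nth 0 (enum_fset K) i).
Proof. by rewrite (big_nth 0) big_mkord. Qed.

Let hmat_free K : affinely_independent K -> row_free (hmat K).
Proof.
move=> indK; rewrite -kermx_eq0; apply/eqP/row_matrixP => i0; rewrite row0.
set t := row i0 _; have tM : t *m hmat K = 0 by rewrite -row_mul mulmx_ker row0.
clearbody t; pose f z : R := oapp (t 0) 0 (insub (index z (enum_fset K)) : option 'I_#|` K|).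
have fE (i : 'I_#|` K|) : f (nth 0 (enum_fset K) i) = t 0 i.
  by rewrite /f index_uniq ?fset_uniq// insubT//= => ?; congr (t 0); exact/val_inj.
have rowM j : \sum_i t 0 i * hmat K i j = 0.
  by have := congr1 (fun A : 'rV[R]_(d + 1) => A 0 j) tM; rewrite !mxE.
have f0 : \sum_(z <- K) f z = 0.
  rewrite sum_fset -[RHS](rowM (rshift d ord0)); apply: eq_bigr => i _.
  by rewrite fE mxE row_mxEr mxE mulr1.
have fz0 : \sum_(z <- K) f z *: z = 0.
  apply/rowP => j; rewrite sum_fset summxE mxE -[RHS](rowM (lshift 1 j)).
  by apply: eq_bigr => i _; rewrite fE [hmat K _ _]mxE row_mxEl mxE.
apply/rowP => i; rewrite mxE -fE; apply: indK => //.
by apply: mem_nth.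
Qed.

Let hmat_entry K (c : 'cV[R]_(d + 1)) (i : 'I_#|` K|) :
  (hmat K *m c) i 0 =
  inner (usubmx c)^T (nth 0 (enum_fset K) i) + (dsubmx c) 0 0.
Proof.
rewrite mxE big_split_ord /= big_ord1 inner_rowE; congr (_ + _).
  by apply: eq_bigr => j _; rewrite [hmat K _ _]mxE row_mxEl !mxE mulrC.
by rewrite [hmat K _ _]mxE row_mxEr !mxE mul1r.
Qed.

Lemma affine_interpolation K v : affinely_independent K ->
  exists ab : 'rV[R]_d * R, forall z, z \in K -> inner ab.1 z + ab.2 = v z.
Proof.
move=> /hmat_free freeM.
pose c := pinvmx (hmat K) *m \col_i v (nth 0 (enum_fset K) i).
exists ((usubmx c)^T, dsubmx c 0 0) => z zK /=.
have iK : (index z (enum_fset K) < #|` K|)%N by rewrite index_mem.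
have := hmat_entry c (Ordinal iK).
by rewrite mulmxA mulmxVp// mul1mx mxE /= nth_index.
Qed.

(** The d + 1 homogeneous coordinate vectors of a simplex are free in dimension
    d + 1, hence span. *)
Lemma affine_unique K a (b : R) : is_simplex K ->
  (forall z, z \in K -> inner a z + b = 0) -> a = 0 /\ b = 0.
Proof.
move=> [cardK indK] ab0; pose c : 'cV[R]_(d + 1) := col_mx a^T (const_mx b).
have fullM : row_full (hmat K).
  by have := hmat_free indK; rewrite /row_free /row_full => /eqP ->; rewrite cardK addn1.
have Mc : hmat K *m c = 0.
  apply/matrixP => i j; rewrite (ord1 j) hmat_entry col_mxKu col_mxKd trmxK [RHS]mxE.
  by rewrite mxE ab0// mem_nth.
have : c = 0 by rewrite -[c]mul1mx -(mulVpmx fullM) -mulmxA Mc mulmx0.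
rewrite -[0]col_mx0 => /eq_col_mx[a0 b0]; split.
  by rewrite -[a]trmxK a0 trmx0.
by have := congr1 (fun A : 'M[R]_1 => A 0 0) b0; rewrite !mxE.
Qed.

(** Gradient and constant term of the barycentric coordinate of z. *)
Definition bary_affine K z : 'rV[R]_d * R := xget (0, 0)
  [set ab | forall y, y \in K -> inner ab.1 y + ab.2 = (y == z)%:R].

Definition bary_coord K z x : R := inner (bary_affine K z).1 x + (bary_affine K z).2.

Lemma bary_coord_vertex K z y : affinely_independent K -> y \in K ->
  bary_coord K z y = (y == z)%:R.
Proof.
move=> /(affine_interpolation (fun y => (y == z)%:R)) [ab abP] yK.
by rewrite /bary_coord /bary_affine; case: xgetP => [? _ |/(_ ab)]; [exact|].
Qed.

Definition slope K v : 'rV[R]_d := \sum_(z <- K) v z *: (bary_affine K z).1.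
Definition interp K v x : R := \sum_(z <- K) v z * bary_coord K z x.

Lemma inner_sumr a (I : Type) (s : seq I) (F : I -> 'rV[R]_d) :
  inner a (\sum_(i <- s) F i) = \sum_(i <- s) inner a (F i).
Proof.
elim/big_rec2 : _ => [|i y1 y2 _ <-]; first by rewrite inner0r.
by rewrite innerDr.
Qed.

Lemma interp_affine K v x :
  interp K v x = inner (slope K v) x + \sum_(z <- K) v z * (bary_affine K z).2.
Proof.
rewrite innerC inner_sumr -big_split; apply: eq_bigr => z _ /=.
by rewrite innerZr -mulrDr innerC.
Qed.

Lemma interp_vertex K v y : affinely_independent K -> y \in K ->
  interp K v y = v y.
Proof.
move=> indK yK; rewrite /interp (bigD1_seq y) ?fset_uniq//= bary_coord_vertex// eqxx.
rewrite mulr1 big1 ?addr0// => z zy.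
by rewrite bary_coord_vertex// eq_sym (negbTE zy) mulr0.
Qed.

Lemma interp_id K v a (b : R) : is_simplex K ->
  (forall z, z \in K -> v z = inner a z + b) ->
  slope K v = a /\ forall x, interp K v x = inner a x + b.
Proof.
move=> ndK vE; have indK := ndK.2.
have [/eqP s0 /eqP c0] : slope K v - a = 0 /\
    \sum_(z <- K) v z * (bary_affine K z).2 - b = 0.
  apply: (affine_unique ndK) => z zK; rewrite innerBl addrACA -opprD.
  by rewrite -interp_affine interp_vertex // vE// subrr.
have sE : slope K v = a by apply/eqP; rewrite -subr_eq0.
by split=> // x; rewrite interp_affine sE; congr (_ + _); apply/eqP; rewrite -subr_eq0.
Qed.

Lemma sum_bary_coord K x : is_simplex K -> \sum_(z <- K) bary_coord K z x = 1.
Proof.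
move=> ndK; have [|_ /(_ x)] := @interp_id K (cst 1) 0 1 ndK.
  by move=> z _; rewrite inner0l add0r.
by rewrite inner0l add0r => <-; apply: eq_bigr => z _; rewrite mul1r.
Qed.

Lemma inner_delta x (i : 'I_d) : inner (delta_mx 0 i) x = x 0 i.
Proof.
rewrite inner_rowE (bigD1 i)//= mxE !eqxx mul1r big1 ?addr0// => j ji.
by rewrite mxE (negbTE ji) andbF mul0r.
Qed.

Lemma bary_coord_point K x : is_simplex K -> \sum_(z <- K) bary_coord K z x *: z = x.
Proof.
move=> ndK; apply/rowP => i; rewrite summxE.
have [|_ /(_ x)] := @interp_id K (fun y => y 0 i) (delta_mx 0 i) 0 ndK.
  by move=> z _; rewrite inner_delta addr0.
rewrite inner_delta addr0 => <-.
by apply: eq_bigr => z _; rewrite mxE mulrC.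
Qed.

Lemma affine_comb K (t : 'rV[R]_d -> R) a (b : R) : \sum_(z <- K) t z = 1 ->
  inner a (\sum_(z <- K) t z *: z) + b = \sum_(z <- K) t z * (inner a z + b).
Proof.
move=> t1; rewrite inner_sumr -[b in LHS]mul1r -t1 mulr_suml -big_split /=.
by apply: eq_bigr => z _; rewrite innerZr mulrDr.
Qed.

(** Barycentric coordinates turn the existential description of a simplex into
    finitely many affine inequalities, which makes it closed. *)
Lemma hullE K : is_simplex K ->
  hull K = [set x | forall z, z \in K -> 0 <= bary_coord K z x].
Proof.
move=> ndK; have indK := ndK.2; apply/seteqP; split => [x [t [t0 t1 xE]] z zK|x lam0];
  last first.
  exists (fun z => bary_coord K z x); split; [exact: lam0| |].
    exact: sum_bary_coord.
  by rewrite bary_coord_point.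
rewrite /bary_coord xE affine_comb// (bigD1_seq z) ?fset_uniq//= -/(bary_coord K z z).
rewrite bary_coord_vertex // eqxx mulr1 big_seq_cond big1 ?addr0 ?t0// => y /andP[yK yz].
by rewrite -/(bary_coord K z y) bary_coord_vertex // (negbTE yz) mulr0.
Qed.

Lemma vertex_hull K z : is_simplex K -> z \in K -> hull K z.
Proof.
move=> ndK zK; have indK := ndK.2; rewrite hullE//= => y yK.
by rewrite bary_coord_vertex// ler0n.
Qed.

Lemma hull_affine_le K a (b M x : _) : hull K x ->
  (forall z, z \in K -> `|inner a z + b| <= M) -> `|inner a x + b| <= M.
Proof.
move=> [t [t0 t1 ->]] zM; rewrite affine_comb// (le_trans (ler_norm_sum _ _ _))//.
rewrite -[leRHS]mul1r -t1 mulr_suml big_seq [leRHS]big_seq; apply: ler_sum => z zK.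
by rewrite normrM ger0_norm ?t0// ler_wpM2l ?t0// zM.
Qed.

(** A point of the common face is a convex combination of common vertices, where
    both interpolants take the nodal values. *)
Lemma interp_common K K' v x : is_simplex K -> is_simplex K' ->
  hull (K `&` K')%fset x -> interp K v x = interp K' v x.
Proof.
move=> [_ indK] [_ indK'] [t [_ t1 ->]]; rewrite !interp_affine !affine_comb//.
apply: eq_big_seq => z; rewrite inE => /andP[zK zK'].
by rewrite -!interp_affine !interp_vertex.
Qed.

(** The linear form a attains its l^1 norm at a corner of the cube. *)
Lemma extremal_shift a (r : R) : 0 <= r -> exists s : 'rV[R]_d,
  (forall i, `|s 0 i| <= r) /\ inner a s = r * \sum_i `|a 0 i|.
Proof.
move=> r0; exists (\row_i (r * Num.sg (a 0 i))); split=> [i|].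
  by rewrite mxE normrM ger0_norm// normr_sg ler_piMr// lern1 leq_b1.
rewrite inner_rowE mulr_sumr; apply: eq_bigr => i _.
by rewrite mxE normrEsg; ring.
Qed.

(** Two opposite corners of the cube realize twice r times the l^1 norm of a. *)
Lemma slope_le_cube a (b M r : R) x : 0 <= r ->
  (forall y, (forall i, `|y 0 i - x 0 i| <= r) -> `|inner a y + b| <= M) ->
  r * \sum_i `|a 0 i| <= M.
Proof.
move=> r0 cubeM; have [s [sr <-]] := extremal_shift a r0.
have /cubeM : forall i, `|(x + s) 0 i - x 0 i| <= r.
  by move=> i; rewrite mxE addrC addKr sr.
have /cubeM : forall i, `|(x - s) 0 i - x 0 i| <= r.
  by move=> i; rewrite !mxE addrC addKr normrN sr.
by rewrite innerBr innerDr !ler_norml => /andP[? ?] /andP[? ?]; lra.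
Qed.

End simplex.

(** * Finite element functions on a conforming mesh *)

Section affine_functions.
Context {R : realType} {d : nat}.
Implicit Types (K : {fset 'rV[R]_d}) (a x y z : 'rV[R]_d).

Lemma affine_continuous a (b : R) : continuous (fun x : 'rV[R]_d => inner a x + b).
Proof.
have -> : (fun x : 'rV[R]_d => inner a x + b) =
    (fun x => \sum_i a 0 i * x 0 i + b).
  by apply/funext => x; rewrite inner_rowE.
move=> x.
have sum_cvg : (fun y : 'rV[R]_d => \sum_i a 0 i * y 0 i) @ x --> \sum_i a 0 i * x 0 i.
  apply: (@cvg_big R 'I_d +%R 0 xpredT _ 'rV[R]_d (nbhs x) _
      (fun i y => a 0 i * y 0 i) (fun i => a 0 i * x 0 i)) => [|i _].
    exact: add_continuous.
  exact: (cvgM (cvg_cst (a 0 i)) (@coord_continuous R 1 d 0 i x)).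
exact: (cvgD sum_cvg (cvg_cst b)).
Qed.

Lemma derive_affine a (b : R) x v : 'D_v (fun y : 'rV[R]_d => inner a y + b) x = inner a v.
Proof.
apply: cvg_lim => //; apply: cvg_near_cst; near=> h.
have h0 : h != 0 by near: h; exact: nbhs_dnbhs_neq.
rewrite /= innerDr innerZr opprD addrACA subrr addr0 addrK.
by rewrite [_ *: _]mulrA mulVf// mul1r.
Unshelve. all: by end_near. Qed.

Lemma hull_closed K : is_simplex K -> closed (hull K).
Proof.
move=> ndK; rewrite hullE//.
have -> : [set x | forall z, z \in K -> 0 <= bary_coord K z x] =
    \bigcap_(z in [set` K]) (bary_coord K z @^-1` [set r | 0 <= r]) by [].
apply: closed_bigI => z _; apply: closed_comp => [x _|]; last exact: closed_ge.
exact: affine_continuous.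
Qed.

Lemma nbhs_rowP (A : set 'rV[R]_d) x : nbhs x A <-> exists2 r : R, 0 < r &
  forall y, (forall i, `|y 0 i - x 0 i| < r) -> A y.
Proof.
rewrite nbhs_ballP; split => [[r r0 rA]|[r r0 rA]].
  exists r => // y yx; apply: rA; split => // i j.
  by rewrite (ord1 i) /ball /= distrC yx.
exists r => // y [_ yx]; apply: rA => i.
by have := yx 0 i; rewrite /ball /= distrC.
Qed.

Lemma hull_coord_le K x i : hull K x -> `|x 0 i| <= \sum_(z <- K) `|z 0 i|.
Proof.
move=> [t [t0 t1 ->]]; rewrite summxE (le_trans (ler_norm_sum _ _ _))//.
rewrite big_seq [leRHS]big_seq; apply: ler_sum => z zK.
rewrite mxE normrM ger0_norm ?t0// ler_piMl// -t1 (bigD1_seq z) ?fset_uniq//=.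
by rewrite lerDl big_seq_cond sumr_ge0// => y /andP[yK _]; exact: t0.
Qed.

Lemma hull_diam K x y i : hull K x -> hull K y ->
  `|x 0 i - y 0 i| <= diam (hull K).
Proof.
move=> Kx Ky; have := entry_le_enorm (x - y) 0 i; rewrite !mxE => /le_trans; apply.
apply: ub_le_sup; last by exists (x, y).
exists (\sum_j (2 * \sum_(z <- K) `|z 0 j|)) => _ [[p q] [/= Kp Kq] <-].
apply: (le_trans (enorm_le_sum _)); apply: ler_sum => j _; rewrite !mxE.
by rewrite (le_trans (ler_normB _ _))// mulr_natl mulr2n lerD// hull_coord_le.
Qed.

Lemma diam_mesh (Th : {fset {fset 'rV[R]_d}}) K : K \in Th ->
  diam (hull K) <= mesh_size Th.
Proof. by move=> KTh; exact: (le_bigmax_seq 0 K xpredT (fun L => diam (hull L)) KTh isT). Qed.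

End affine_functions.

Section mesh_functions.
Context {R : realType} {d : nat}.
Variables (Omega : set 'rV[R]_d) (Th : {fset {fset 'rV[R]_d}}).
Hypothesis tri : triangulation Omega Th.
Implicit Types (K : {fset 'rV[R]_d}) (u v : 'rV[R]_d -> R) (x y z : 'rV[R]_d).

Lemma cell_simplex K : K \in Th -> is_simplex K.
Proof. by case: tri => + _ _ => /[apply]. Qed.

Lemma nodeP z : reflect (exists2 K, K \in Th & z \in K) (z \in nodes Th).
Proof.
apply: (iffP (bigfcupP _ _ _ _)) => [[K /andP[KTh _] zK]|[K KTh zK]]; exists K => //.
by rewrite KTh.
Qed.

Lemma cell_closure K x : K \in Th -> hull K x -> closure Omega x.
Proof. by move=> KTh Kx; case: tri => _ -> _; exists K. Qed.

Lemma closure_cell x : closure Omega x -> exists2 K, K \in Th & hull K x.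
Proof. by case: tri => _ -> _ [K]; exists K. Qed.

(** On a point shared by several cells any of them may be used, by
    interp_common and conformity. *)
Definition interpolant v x : R :=
  interp (xget fset0 [set K | K \in Th /\ hull K x]) v x.

Lemma interpolantE v K x : K \in Th -> hull K x -> interpolant v x = interp K v x.
Proof.
move=> KTh Kx; rewrite /interpolant; case: xgetP => [K' _ [K'Th K'x]|/(_ K) []//].
apply: interp_common; [exact: cell_simplex..|].
by case: tri => _ _ <-.
Qed.

Lemma interpolant_node v z : z \in nodes Th -> interpolant v z = v z.
Proof.
move=> /nodeP[K KTh zK]; have ndK := cell_simplex KTh.
rewrite (interpolantE _ KTh); last exact: vertex_hull.
by rewrite interp_vertex//; case: ndK.
Qed.

(** Pasting lemma: the cells are closed and finitely many. *)
Lemma within_bigcup_continuous (f : 'rV[R]_d -> R) (s : seq {fset 'rV[R]_d}) :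
  (forall K, K \in s -> is_simplex K /\ {within hull K, continuous f}) ->
  closed (\bigcup_(K in [set K | K \in s]) hull K) /\
  {within \bigcup_(K in [set K | K \in s]) hull K, continuous f}.
Proof.
elim: s => [|K s IH] sP.
  have -> : \bigcup_(K in [set K | K \in [::]]) hull K = set0 :> set 'rV[R]_d.
    by apply/seteqP; split => // x [].
  by split; [exact: closed0|exact: continuous_subspace0].
have -> : \bigcup_(L in [set L | L \in K :: s]) hull L =
    hull K `|` \bigcup_(L in [set L | L \in s]) hull L.
  apply/seteqP; split => [x [L]|x [Kx|[L Ls Lx]]] /=.
  - by rewrite inE => /predU1P[->|Ls] Lx; [left|right; exists L].
  - by exists K => //=; rewrite mem_head.
  - by exists L => //=; rewrite inE Ls orbT.
have [|clU cU] := IH; first by move=> L Ls; apply: sP; rewrite inE Ls orbT.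
have [ndK cK] := sP K (mem_head _ _).
by split; [apply: closedU|apply: withinU_continuous] => //; exact: hull_closed.
Qed.

Lemma interpolant_Vh v : Vh Omega Th (interpolant v).
Proof.
split; last first.
  move=> K KTh; exists (slope K v), (\sum_(z <- K) v z * (bary_affine K z).2) => x Kx.
  by rewrite (interpolantE _ KTh)// interp_affine.
case: tri => _ -> _; apply: (within_bigcup_continuous _).2 => K KTh; split.
  exact: cell_simplex.
apply: (@subspace_eq_continuous _ _ _ (interp K v)) => [x /set_mem Kx|].
  exact: esym (interpolantE v KTh Kx).
apply: continuous_subspaceT => x.
have -> : interp K v = fun x => inner (slope K v) x + \sum_(z <- K) v z * (bary_affine K z).2.
  by apply/funext => y; rewrite interp_affine.
exact: affine_continuous.
Qed.

Lemma Vh_interp u K x : Vh Omega Th u -> K \in Th -> hull K x ->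
  u x = interp K u x.
Proof.
move=> [_ /[swap] KTh /(_ _ KTh)[a [b ab]]] Kx; rewrite ab//.
have ndK := cell_simplex KTh.
have [|_ ->//] := interp_id (v := u) (a := a) (b := b) ndK.
by move=> z zK; rewrite ab//; exact: vertex_hull.
Qed.

Lemma grad_cell u K x : Vh Omega Th u -> K \in Th -> (hull K)° x ->
  grad Th u x = slope K u.
Proof.
move=> uVh KTh Kx; rewrite /grad asboolT; last by exists K.
apply/rowP => j; rewrite mxE.
have -> : 'D_(delta_mx 0 j) u x = 'D_(delta_mx 0 j)
    (fun y => inner (slope K u) y + \sum_(z <- K) u z * (bary_affine K z).2) x.
  apply: near_eq_derive; apply: filterS Kx => y Ky.
  by rewrite (Vh_interp uVh KTh)// interp_affine.
by rewrite derive_affine innerC inner_delta.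
Qed.

Lemma grad_out u x : (forall K, K \in Th -> ~ (hull K)° x) -> grad Th u x = 0.
Proof. by move=> xP; rewrite /grad asboolF// => -[K KTh /xP]. Qed.

(** A vertex w of K outside K' has a barycentric coordinate that vanishes on the
    common face; if the interiors met, this affine function would vanish on an
    open set, hence everywhere, although it is 1 at w. *)
Lemma cell_interiors_disjoint K K' x : K \in Th -> K' \in Th ->
  (hull K)° x -> (hull K')° x -> K = K'.
Proof.
move=> KTh K'Th Kx K'x; have [cardK indK] := cell_simplex KTh.
have [cardK' indK'] := cell_simplex K'Th.
apply/eqP; apply/negPn/negP => neqK.
have /fsubsetPn[w wK wK'] : ~~ (K `<=` K')%fset.
  by apply: contra neqK => KK'; rewrite eqEfcard KK' cardK cardK' leqnn.
have /nbhs_rowP[r r0 rP] : nbhs x (hull (K `&` K')%fset).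
  by case: tri => _ _ <- //; apply: filterI.
have lam0 y : (forall i, `|y 0 i - x 0 i| < r) -> bary_coord K w y = 0.
  move=> /rP [t [_ t1 ->]]; rewrite /bary_coord affine_comb//.
  rewrite big_seq big1// => z; rewrite inE => /andP[zK zK'].
  rewrite -/(bary_coord K w z) bary_coord_vertex// (_ : z == w = false) ?mulr0//.
  by apply: contraNF wK' => /eqP <-.
have sum0 : \sum_i `|(bary_affine K w).1 0 i| = 0.
  apply/eqP; rewrite eq_le sumr_ge0 ?andbT//.
  have r20 : 0 < r / 2 by rewrite divr_gt0.
  rewrite -(pmulr_rle0 _ r20); apply: (@slope_le_cube _ _ _ (bary_affine K w).2 _ _ x).
    exact: ltW.
  move=> y yx; rewrite -/(bary_coord K w y) lam0 ?normr0// => i.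
  by rewrite (le_lt_trans (yx i))//; lra.
have a0 : (bary_affine K w).1 = 0.
  apply/rowP => i; rewrite mxE; apply/normr0_eq0/eqP.
  by have := sum0 => /eqP; rewrite psumr_eq0// => /allP/(_ i (mem_index_enum i))/implyP; exact.
have := lam0 x; rewrite /bary_coord a0 inner0l add0r => b0.
have := bary_coord_vertex w indK wK; rewrite /bary_coord a0 inner0l add0r b0 ?eqxx => [/eqP|i].
  by rewrite eq_sym oner_eq0.
by rewrite subrr normr0.
Qed.

Lemma hatP z : z \in nodes Th -> Vh Omega Th (hat Omega Th z) /\
  forall y, y \in nodes Th -> hat Omega Th z y = (y == z)%:R.
Proof.
move=> zTh; rewrite /hat; case: xgetP => [//|].
move=> /(_ (interpolant (fun y => (y == z)%:R))) []; split.
  exact: interpolant_Vh.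
by move=> y yTh; rewrite interpolant_node.
Qed.

Lemma vertex_node K z : K \in Th -> z \in K -> z \in nodes Th.
Proof. by move=> KTh zK; apply/nodeP; exists K. Qed.

Lemma eq_interp K u v x : (forall z, z \in K -> u z = v z) ->
  interp K u x = interp K v x.
Proof. by move=> uv; apply: eq_big_seq => z /uv ->. Qed.

Lemma eq_slope K u v : (forall z, z \in K -> u z = v z) -> slope K u = slope K v.
Proof. by move=> uv; apply: eq_big_seq => z /uv ->. Qed.

Lemma hat_cell z K x : z \in nodes Th -> K \in Th -> hull K x ->
  hat Omega Th z x = if z \in K then bary_coord K z x else 0.
Proof.
move=> zTh KTh Kx; have [hVh hE] := hatP zTh.
rewrite (Vh_interp hVh KTh Kx) (@eq_interp _ _ (fun y => (y == z)%:R)); last first.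
  by move=> y yK; rewrite hE// (vertex_node KTh).
rewrite /interp; case: ifPn => [zK|zK].
  rewrite (bigD1_seq z) ?fset_uniq//= eqxx mul1r big1 ?addr0// => y /negPf ->.
  by rewrite mul0r.
rewrite big_seq big1// => y yK; rewrite (_ : y == z = false) ?mul0r//.
by apply: contraNF zK => /eqP <-.
Qed.

Lemma slope_hat z K : z \in nodes Th -> K \in Th ->
  slope K (hat Omega Th z) = if z \in K then (bary_affine K z).1 else 0.
Proof.
move=> zTh KTh; have [_ hE] := hatP zTh.
rewrite (@eq_slope _ _ (fun y => (y == z)%:R)); last first.
  by move=> y yK; rewrite hE// (vertex_node KTh).
rewrite /slope; case: ifPn => [zK|zK].
  rewrite (bigD1_seq z) ?fset_uniq//= eqxx scale1r big1 ?addr0// => y /negPf ->.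
  by rewrite scale0r.
rewrite big_seq big1// => y yK; rewrite (_ : y == z = false) ?scale0r//.
by apply: contraNF zK => /eqP <-.
Qed.

End mesh_functions.

(** * Lebesgue measure of open sets and cubes *)

Section lebesgue_row.
Context {R : realType}.

Definition tuple_set {d : nat} (A : set 'rV[R]_d) : set (d.-tuple (measurableTypeR R)) :=
  row_of_tuple @^-1` A.

Definition cube {d : nat} (c : 'rV[R]_d) (r : R) : set 'rV[R]_d :=
  [set y | forall i, `|y 0 i - c 0 i| < r].

Lemma tuple_set_cube {d : nat} (c : 'rV[R]_d) (r : R) : tuple_set (cube c r) =
  \bigcap_(i in [set: 'I_d]) ((fun t : d.-tuple (measurableTypeR R) => tnth t i) @^-1`
     [set` `]c 0 i - r, c 0 i + r[]).
Proof.
apply/seteqP; split => t tc i; first move=> _.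
  by have := tc i; rewrite /= mxE in_itv/= ltr_distl.
by have := tc i I; rewrite /= mxE in_itv/= ltr_distl.
Qed.

Lemma measurable_cube {d : nat} (c : 'rV[R]_d) (r : R) :
  measurable (tuple_set (cube c r)).
Proof.
rewrite tuple_set_cube; apply: fin_bigcap_measurable => // i _.
rewrite -[X in measurable X]setTI; apply: measurable_tnth => //.
Qed.

Lemma lebesgue_cube {d : nat} (c : 'rV[R]_d) (r : R) : 0 <= r ->
  lebesgue_tuple R d (tuple_set (cube c r)) = ((2 * r) ^+ d)%:E.
Proof.
move=> r0; elim: d c => [|d IH] c.
  by rewrite expr0 /= diracE mem_set// => -[].
rewrite /= /cons_measure /pushforward.
have -> : @tuple_cons _ (measurableTypeR R) d @^-1` tuple_set (cube c r) =
    [set` `]c 0 ord0 - r, c 0 ord0 + r[] `*`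
    tuple_set (cube (\row_i c 0 (lift ord0 i)) r).
  apply/seteqP; split => -[x t] /= => [xt|[x0 t0] i].
    split=> [|i]; last by have := xt (lift ord0 i); rewrite !mxE tnthS.
    by have := xt ord0; rewrite mxE tnth0 in_itv/= ltr_distl.
  have [->|[j ->]] : i = ord0 \/ exists j, i = lift ord0 j.
    by case: (unliftP ord0 i) => [j ->|->]; [right; exists j|left].
  - by rewrite mxE tnth0; move: x0; rewrite in_itv/= ltr_distl.
  - by have := t0 j; rewrite !mxE tnthS.
rewrite product_measure1E//; last exact: measurable_cube.
rewrite [X in (X * _)%E]lebesgue_measure_itv/= IH lte_fin.
case: ltP => cr.
  by rewrite -EFinB -EFinM exprS; congr (_ * _)%:E; ring.
have -> : r = 0 by apply/eqP; rewrite eq_le r0 andbT; lra.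
by rewrite mul0e mulr0 exprS mul0r.
Qed.

(** An open set is the countable union of the cubes with rational centre and
    radius 1 / (n + 1) that it contains. *)
Lemma measurable_open {d : nat} (U : set 'rV[R]_d) : open U -> measurable (tuple_set U).
Proof.
move=> oU.
pose C (p : {ffun 'I_d -> rat} * nat) : set 'rV[R]_d :=
  cube (\row_i ratr (p.1 i)) p.2.+1%:R^-1.
have -> : tuple_set U = \bigcup_(p in [set: {ffun 'I_d -> rat} * nat])
    (if `[< C p `<=` U >] then tuple_set (C p) else set0).
  apply/seteqP; split => [t Ut|t [p _]]; last by case: asboolP => [CU /CU|].
  have /nbhs_rowP[r r0 rU] : nbhs (row_of_tuple t) U by move: oU; rewrite openE; apply.
  have [n nr] : exists n : nat, n.+1%:R^-1 < r / 2.
    exists (Num.truncn (r / 2)^-1); rewrite invf_plt ?posrE ?divr_gt0//.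
    by rewrite truncnS_gt.
  have n0 : (0 : R) < n.+1%:R^-1 by rewrite invr_gt0.
  have /choice[q qP] : forall i, exists q : rat, `|tnth t i - ratr q| < n.+1%:R^-1 :> R.
    move=> i; have [|q] := @rat_in_itvoo R (tnth t i - n.+1%:R^-1) (tnth t i + n.+1%:R^-1).
      by rewrite ltrD2l gt0_cp.
    by rewrite in_itv/= -ltr_distl distrC; exists q.
  exists ([ffun i => q i], n) => //=; rewrite asboolT; first by move=> i; rewrite !mxE ffunE.
  move=> y Cy; apply: rU => i; rewrite mxE.
  have := Cy i; rewrite mxE ffunE /= => yq.
  by rewrite -(subrKA (ratr (q i))) (le_lt_trans (ler_normD _ _))// distrC (splitr r)
    ltrD// (lt_trans _ nr)// distrC.
apply: countable_bigcupT_measurable => [|p]; first exact: countableP.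
by case: ifP => _ //; exact: measurable_cube.
Qed.

End lebesgue_row.

(** * Integration over a bounded open set *)

Section integration.
Context {R : realType} {d : nat}.
Variables (Omega : set 'rV[R]_d).
Hypothesis openO : open Omega.
Hypothesis bndO : bounded_set Omega.
Local Notation mu := (lebesgue_tuple R d).

Definition domain_integrable (f : 'rV[R]_d -> R) :=
  mu.-integrable (tuple_set Omega) (EFin \o (f \o row_of_tuple)).

Lemma bounded_cube : exists2 r : R, 0 <= r & Omega `<=` cube 0 r.
Proof.
have [M [_ MP]] := bndO.
have N0 : 0 <= `|M| + 2 by rewrite addr_ge0.
exists (`|M| + 2) => // x Ox i; rewrite mxE subr0.
have /MP/(_ _ Ox) : M < `|M| + 1 by rewrite (le_lt_trans (ler_norm _))// ltrDl.
rewrite /= => /mx_norm_le xM; have := xM _ 0 i; rewrite addr_ge0// => /(_ isT).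
by move=> /le_lt_trans; apply; rewrite ltrD2l; lra.
Qed.

Let mO : measurable (tuple_set Omega) := measurable_open openO.

Lemma finite_domain : (mu (tuple_set Omega) < +oo)%E.
Proof.
have [r r0 Or] := bounded_cube.
apply: (@le_lt_trans _ _ (mu (tuple_set (cube 0 r)))).
  by rewrite le_measure ?inE//; [exact: measurable_cube|move=> t /Or].
by rewrite lebesgue_cube// ltry.
Qed.

Lemma indic_integrable (A : set 'rV[R]_d) : measurable (tuple_set A) ->
  domain_integrable \1_A.
Proof.
move=> mA; apply: measurable_bounded_integrable => //.
- exact: finite_domain.
- have -> : (\1_A \o row_of_tuple : d.-tuple (measurableTypeR R) -> R) =
      \1_(tuple_set A) by apply/funext => t; rewrite /= !indicE.
  exact: measurable_indic.
- exists 1; split=> // M M1 t _ /=; rewrite indicE.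
  by rewrite ger0_norm ?ler0n// (le_trans _ (ltW M1))// lern1 leq_b1.
Qed.

Lemma integral_onD f g : domain_integrable f -> domain_integrable g ->
  integral_on Omega (fun x => f x + g x) = integral_on Omega f + integral_on Omega g.
Proof. by move=> fi gi; exact: RintegralD. Qed.

Lemma integral_onZ c f : domain_integrable f ->
  integral_on Omega (fun x => c * f x) = c * integral_on Omega f.
Proof. by move=> fi; exact: RintegralZl. Qed.

Lemma integrableZ c f : domain_integrable f -> domain_integrable (fun x => c * f x).
Proof.
move=> fi; rewrite /domain_integrable.
have -> : EFin \o ((fun x => c * f x) \o row_of_tuple) =
    (fun t : d.-tuple (measurableTypeR R) => c%:E * (f (row_of_tuple t))%:E)%E.
  by apply/funext => t /=; rewrite EFinM.
by apply: integrableZl => //; exact: fi.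
Qed.

Lemma integrable_sumZ (I : Type) (s : seq I) (c : I -> R) (f : I -> 'rV[R]_d -> R) :
  (forall i, domain_integrable (f i)) ->
  domain_integrable (fun x => \sum_(i <- s) c i * f i x).
Proof.
move=> fi; rewrite /domain_integrable.
have -> : EFin \o ((fun x => \sum_(i <- s) c i * f i x) \o row_of_tuple) =
    (fun t : d.-tuple (measurableTypeR R) =>
      \sum_(i <- s) (c i * f i (row_of_tuple t))%:E)%E.
  by apply/funext => t /=; rewrite sumEFin.
by apply: integrable_sum => // i _; exact: integrableZ.
Qed.

Lemma integral_on_sumZ (I : Type) (s : seq I) (c : I -> R) (f : I -> 'rV[R]_d -> R) :
  (forall i, domain_integrable (f i)) ->
  integral_on Omega (fun x => \sum_(i <- s) c i * f i x) =
  \sum_(i <- s) c i * integral_on Omega (f i).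
Proof.
move=> fi; elim: s => [|i s IH].
  rewrite big_nil /integral_on; under eq_Rintegral do rewrite big_nil.
  by rewrite Rintegral_cst// mul0r.
rewrite big_cons -IH -integral_onZ// -integral_onD; [|exact: integrableZ|exact: integrable_sumZ].
by apply: eq_Rintegral => t _; rewrite big_cons.
Qed.

Lemma le_integral_on f g : domain_integrable f -> domain_integrable g ->
  (forall x, Omega x -> f x <= g x) -> integral_on Omega f <= integral_on Omega g.
Proof. by move=> fi gi fg; apply: le_Rintegral => // t; exact: fg. Qed.

Lemma integral_on_indic (A : set 'rV[R]_d) : measurable (tuple_set A) ->
  integral_on Omega \1_A = fine (mu (tuple_set A `&` tuple_set Omega)).
Proof.
move=> mA; rewrite /integral_on /Rintegral; congr fine.
by rewrite -integral_indic.
Qed.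

Lemma integral_on_indic_ge0 (A : set 'rV[R]_d) : 0 <= integral_on Omega \1_A.
Proof. by apply: Rintegral_ge0 => t _; rewrite indicE ler0n. Qed.

Lemma integral_on_indic_cube c r : 0 <= r -> cube c r `<=` Omega ->
  integral_on Omega \1_(cube c r) = (2 * r) ^+ d.
Proof.
move=> r0 cO; rewrite integral_on_indic; last exact: measurable_cube.
rewrite setIidl; last by move=> t /cO.
by rewrite lebesgue_cube.
Qed.

Lemma integral_on_indic_le (A : set 'rV[R]_d) c r : measurable (tuple_set A) ->
  0 <= r -> A `<=` cube c r -> integral_on Omega \1_A <= (2 * r) ^+ d.
Proof.
move=> mA r0 AC; rewrite integral_on_indic// -lee_fin fineK; last first.
  rewrite ge0_fin_numE// (le_lt_trans _ finite_domain)//.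
  by rewrite le_measure ?inE//; exact: measurableI.
rewrite -(lebesgue_cube c r0); apply: (le_measure mu); rewrite ?inE.
- exact: measurableI.
- exact: measurable_cube.
- by move=> t [/AC].
Qed.

Lemma continuous_bounded_integrable f M : {within closure Omega, continuous f} ->
  (forall x, Omega x -> `|f x| <= M) -> domain_integrable f.
Proof.
move=> cf fM; apply: measurable_bounded_integrable => //.
- exact: finite_domain.
- have {}cf : {within Omega, continuous f}.
    by apply: continuous_subspaceW cf; exact: subset_closure.
  apply: (measurability _ (RGenOInfty.measurableE R)) => _ [_ [a ->] <-].
  rewrite preimage_itvoy.
  have -> : tuple_set Omega `&` [set t | a < (f \o row_of_tuple) t] =
      tuple_set (Omega `&` f @^-1` [set y | a < y]) by [].
  apply: measurable_open; rewrite openE => x [Ox fx].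
  have cfx : {for x, continuous f}.
    by move: cf; rewrite continuous_open_subspace// => /(_ x); apply; rewrite inE.
  apply: filterI; first by move: openO; rewrite openE; apply.
  by apply: cfx; apply: open_nbhs_nbhs; split => //; exact: open_gt.
- exists M; split=> [|N MN t Ot]; first exact: num_real.
  by apply: le_trans (ltW MN); exact: fM.
Qed.

End integration.

Section disjoint_sets.
Context {R : realType} {I : eqType} {T : Type}.
Variables (s : seq I) (A : I -> set T).
Hypothesis uniq_s : uniq s.
Hypothesis disj : forall i j x, i \in s -> j \in s -> A i x -> A j x -> i = j.

Lemma sum_disjoint_in (c : I -> R) i x : i \in s -> A i x ->
  \sum_(j <- s) c j * \1_(A j) x = c i.
Proof.
move=> si Ax; rewrite (bigD1_seq i)//= indicE mem_set// mulr1 big_seq_cond big1 ?addr0//.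
move=> j /andP[sj ji]; rewrite indicE memNset ?mulr0// => Ajx.
by move/eqP: ji; apply; apply: disj Ajx Ax.
Qed.

Lemma sum_disjoint_out (c : I -> R) x : (forall i, i \in s -> ~ A i x) ->
  \sum_(j <- s) c j * \1_(A j) x = 0.
Proof.
move=> Ax; rewrite big_seq big1// => j sj.
by rewrite indicE memNset ?mulr0//; exact: Ax.
Qed.

End disjoint_sets.

(** * Stiffness form and lumped Laplacian *)

Section stiffness.
Context {R : realType} {d : nat}.
Variables (Omega : set 'rV[R]_d) (Th : {fset {fset 'rV[R]_d}}).
Hypothesis polyO : polyhedral_domain Omega.
Hypothesis tri : triangulation Omega Th.
Implicit Types (K : {fset 'rV[R]_d}) (u v w : 'rV[R]_d -> R) (x y z : 'rV[R]_d).

Let openO : open Omega. Proof. by case: polyO => -[]. Qed.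
Let bndO : bounded_set Omega. Proof. by case: polyO => -[]. Qed.

Lemma cell_interior_domain K : K \in Th -> (hull K)° `<=` Omega.
Proof.
move=> KTh; case: polyO => _ [<- _]; apply: interiorS => x Kx.
exact: (cell_closure tri) Kx.
Qed.

Lemma measurable_cell K : measurable (tuple_set (hull K)°).
Proof. exact: measurable_open (@open_interior _ _). Qed.

Definition cell_volume K : R := integral_on Omega \1_((hull K)°).

Lemma cell_volume_ge0 K : 0 <= cell_volume K.
Proof. exact: integral_on_indic_ge0. Qed.

Let disj K K' x : K \in enum_fset Th -> K' \in enum_fset Th ->
  (hull K)° x -> (hull K')° x -> K = K'.
Proof. by move=> KTh K'Th; exact: (cell_interiors_disjoint tri KTh K'Th). Qed.

(** Gradients vanish outside the open cells by definition, so the integrand is a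
    combination of indicators of disjoint sets. *)
Lemma L2inner_cells {m n : nat} (F G : 'rV[R]_d -> 'M[R]_(m, n))
    (FK GK : {fset 'rV[R]_d} -> 'M[R]_(m, n)) :
  (forall K x, K \in Th -> (hull K)° x -> F x = FK K /\ G x = GK K) ->
  (forall x, (forall K, K \in Th -> ~ (hull K)° x) -> F x = 0) ->
  L2inner Omega F G = \sum_(K <- Th) inner (FK K) (GK K) * cell_volume K.
Proof.
move=> FG F0; rewrite /cell_volume -integral_on_sumZ//; last first.
  by move=> K; apply: indic_integrable => //; exact: measurable_cell.
rewrite /L2inner; congr integral_on; apply/funext => x.
have [[K KTh Kx]|xout] := pselect (exists2 K, K \in Th & (hull K)° x).
  have [-> ->] := FG _ _ KTh Kx.
  by rewrite (sum_disjoint_in (fset_uniq Th) disj (fun K => inner (FK K) (GK K)) KTh Kx).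
have xP K : K \in Th -> ~ (hull K)° x by move=> KTh Kx; apply: xout; exists K.
by rewrite F0// inner0l sum_disjoint_out.
Qed.

Definition stiff u v : R := \sum_(K <- Th) inner (slope K u) (slope K v) * cell_volume K.

Lemma L2inner_grad u v : Vh Omega Th u -> Vh Omega Th v ->
  L2inner Omega (grad Th u) (grad Th v) = stiff u v.
Proof.
move=> uVh vVh; rewrite (@L2inner_cells _ _ _ _ (fun K => slope K u) (fun K => slope K v))//.
  by move=> K x KTh Kx; rewrite !(grad_cell tri _ KTh Kx).
by move=> x /grad_out.
Qed.

Let coord (U : 'rV[R]_d -> 'rV[R]_3) (k : 'I_3) := fun y => U y 0 k.

Lemma sum_stiff_inner (U P : 'rV[R]_d -> 'rV[R]_3) :
  \sum_(K <- Th) inner (\matrix_(k, j) slope K (coord U k) 0 j)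
     (\matrix_(k, j) slope K (coord P k) 0 j) * cell_volume K =
  \sum_k stiff (coord U k) (coord P k).
Proof.
rewrite exchange_big; apply: eq_bigr => K _; rewrite -mulr_suml; congr (_ * _).
apply: eq_bigr => k _; rewrite inner_rowE.
by apply: eq_bigr => j _; rewrite !mxE.
Qed.

Lemma L2inner_vgrad U P : VVh Omega Th U -> VVh Omega Th P ->
  L2inner Omega (vgrad Th U) (vgrad Th P) = \sum_k stiff (coord U k) (coord P k).
Proof.
move=> UV PV; rewrite -sum_stiff_inner; apply: L2inner_cells => [K x KTh Kx|x xout].
  split; apply/matrixP => k j; rewrite !mxE (grad_cell tri _ KTh Kx)//.
by apply/matrixP => k j; rewrite !mxE grad_out// mxE.
Qed.

Lemma L2inner_vgrad_hat U (X : 'rV[R]_3) z : VVh Omega Th U -> z \in nodes Th ->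
  L2inner Omega (vgrad Th U) (fun x => X^T *m grad Th (hat Omega Th z) x) =
  \sum_k X 0 k * stiff (coord U k) (hat Omega Th z).
Proof.
move=> UV zTh; have [hV _] := hatP tri zTh.
rewrite (@L2inner_cells _ _ _ _ (fun K => \matrix_(k, j) slope K (coord U k) 0 j)
  (fun K => X^T *m slope K (hat Omega Th z))).
- under [RHS]eq_bigr do rewrite mulr_sumr.
  rewrite exchange_big; apply: eq_bigr => K _ /=.
  under [RHS]eq_bigr do rewrite mulrA; rewrite -mulr_suml; congr (_ * _).
  apply: eq_bigr => k _; rewrite inner_rowE mulr_sumr; apply: eq_bigr => j _.
  by rewrite !mxE big_ord1 !mxE; ring.
- move=> K x KTh Kx; split; last by rewrite (grad_cell tri _ KTh Kx).
  by apply/matrixP => k j; rewrite !mxE (grad_cell tri _ KTh Kx).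
- by move=> x xout; apply/matrixP => k j; rewrite !mxE grad_out// mxE.
Qed.

Lemma slope_lin K (a b : R) u v :
  slope K (fun x => a * u x + b * v x) = a *: slope K u + b *: slope K v.
Proof.
rewrite /slope !scaler_sumr -big_split; apply: eq_bigr => z _ /=.
by rewrite !scalerA scalerDl.
Qed.

Lemma stiff_linl (a b : R) u v w :
  stiff (fun x => a * u x + b * v x) w = a * stiff u w + b * stiff v w.
Proof.
rewrite /stiff !mulr_sumr -big_split; apply: eq_bigr => K _ /=.
by rewrite slope_lin innerDl !innerZl; ring.
Qed.

Lemma stiffC u v : stiff u v = stiff v u.
Proof. by apply: eq_bigr => K _; rewrite innerC. Qed.

Lemma eq_stiff u u' v : (forall z, z \in nodes Th -> u z = u' z) ->
  stiff u v = stiff u' v.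
Proof.
move=> uu; apply: eq_big_seq => K KTh; congr (inner _ _ * _).
by apply: eq_slope => z zK; rewrite uu// (vertex_node KTh).
Qed.

(** On a cell only the hat functions of its own vertices contribute. *)
Lemma slope_hats K v : K \in Th ->
  slope K v = \sum_(z <- nodes Th) v z *: slope K (hat Omega Th z).
Proof.
move=> KTh; rewrite (eq_big_seq (fun z => if z \in K then v z *: (bary_affine K z).1 else 0)).
  rewrite -big_mkcond -big_filter; apply: perm_big; apply: uniq_perm.
  - exact: fset_uniq.
  - by rewrite filter_uniq// fset_uniq.
  - move=> z; rewrite mem_filter; case: (boolP (z \in K)) => // zK.
    by rewrite (vertex_node KTh zK).
move=> z zTh; rewrite (slope_hat tri zTh KTh).
by case: ifP => // _; rewrite scaler0.
Qed.

Lemma stiff_hats u v :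
  stiff u v = \sum_(z <- nodes Th) v z * stiff u (hat Omega Th z).
Proof.
under eq_bigr do rewrite mulr_sumr; rewrite exchange_big; apply: eq_big_seq => K KTh /=.
rewrite (slope_hats v KTh) inner_sumr mulr_suml; apply: eq_bigr => z _.
by rewrite innerZr mulrA.
Qed.

(** The opposite of the discrete Laplacian, as an operator on nodal values. *)
Definition lap u z : R := stiff u (hat Omega Th z) / beta Omega Th z.

Lemma lap_lin (a b : R) u v z :
  lap (fun x => a * u x + b * v x) z = a * lap u z + b * lap v z.
Proof. by rewrite /lap stiff_linl; ring. Qed.

Lemma eq_lap u u' z :
  (forall y, y \in nodes Th -> u y = u' y) -> lap u z = lap u' z.
Proof. by move=> uu; rewrite /lap (eq_stiff _ uu). Qed.

Section positive_weights.
Hypothesis beta_gt0 : forall z, z \in nodes Th -> 0 < beta Omega Th z.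

Lemma beta_lap u z : z \in nodes Th ->
  beta Omega Th z * lap u z = stiff u (hat Omega Th z).
Proof. by move=> zTh; rewrite /lap mulrCA divff ?mulr1// gt_eqF// beta_gt0. Qed.

Lemma hprod_lap u v :
  \sum_(z <- nodes Th) beta Omega Th z * (lap u z * v z) = stiff u v.
Proof.
rewrite stiff_hats; apply: eq_big_seq => z zTh.
by rewrite -beta_lap//; ring.
Qed.

Lemma dlaplace_scalarP u : Vh Omega Th u ->
  Vh Omega Th (dlaplace_scalar Omega Th u) /\
  forall z, z \in nodes Th -> dlaplace_scalar Omega Th u z = - lap u z.
Proof.
move=> uV; rewrite /dlaplace_scalar; case: xgetP => [w _ [wV wE]|].
  split=> // z zTh; have [hV hE] := hatP tri zTh.
  have := wE _ hV; rewrite L2inner_grad// -beta_lap// /hprod_scalar.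
  rewrite (bigD1_seq z) ?fset_uniq//= big_seq_cond big1 => [|y /andP[yTh yz]].
    rewrite hE// eqxx mulr1 addr0 -mulrN => /(mulfI _) <-; first by rewrite opprK.
    by rewrite gt_eqF// beta_gt0.
  by rewrite hE// (negbTE yz) !mulr0.
move=> /(_ (interpolant Th (fun z => - lap u z))) []; split.
  exact: (interpolant_Vh tri).
move=> phi phiV; rewrite L2inner_grad// -hprod_lap /hprod_scalar -sumrN.
apply: eq_big_seq => z zTh; rewrite (interpolant_node tri)//; ring.
Qed.

End positive_weights.
End stiffness.

(** * Bounds on a quasi-uniform mesh *)

Section quasiuniform_bounds.
Context {R : realType} {d : nat}.
Variables (Omega : set 'rV[R]_d) (kappa : R) (Th : {fset {fset 'rV[R]_d}}).
Hypothesis d_gt0 : (0 < d)%N.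
Hypothesis kappa_gt0 : 0 < kappa.
Hypothesis polyO : polyhedral_domain Omega.
Hypothesis tri : triangulation Omega Th.
Hypothesis quasi : quasiuniform kappa Th.
Implicit Types (K : {fset 'rV[R]_d}) (u v w : 'rV[R]_d -> R) (x y z : 'rV[R]_d).

Local Notation h := (mesh_size Th).
Hypothesis h_gt0 : 0 < h.

(** Half-side of a cube inscribed in the ball of radius kappa h; the factor
    1 / d compares the Euclidean norm with the sup norm. *)
Definition inradius : R := kappa * h / d%:R.
Local Notation rho := inradius.

Let dR_gt0 : (0 : R) < d%:R. Proof. by rewrite ltr0n. Qed.
Let rho_gt0 : 0 < rho. Proof. by rewrite divr_gt0// mulr_gt0. Qed.

Lemma inscribed_cube K : K \in Th ->
  exists x, forall y, (forall i, `|y 0 i - x 0 i| <= rho) -> hull K y.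
Proof.
move=> /quasi[x xK]; exists x => y yx; apply: xK => /=.
apply: le_trans (enorm_le_sum _) _.
have -> : kappa * h = \sum_(i < d) rho.
  by rewrite sumr_const card_ord -mulr_natr /rho mulfVK// gt_eqF.
by apply: ler_sum => i _; rewrite !mxE yx.
Qed.

Lemma slope_bound K u (M : R) : K \in Th -> (forall z, z \in K -> `|u z| <= M) ->
  \sum_i `|slope K u 0 i| <= M / rho.
Proof.
move=> KTh uM; have [x xK] := inscribed_cube KTh; rewrite ler_pdivlMr// mulrC.
have [_ indK] := cell_simplex tri KTh.
apply: (@slope_le_cube _ _ _ (\sum_(z <- K) u z * (bary_affine K z).2) _ _ x); first exact: ltW.
move=> y /xK Ky; apply: hull_affine_le Ky _ => z zK.
by rewrite -interp_affine interp_vertex// uM.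
Qed.

Lemma hat_slope_bound K z : K \in Th -> z \in nodes Th ->
  \sum_i `|slope K (hat Omega Th z) 0 i| <= if z \in K then rho^-1 else 0.
Proof.
move=> KTh zTh; have [_ hE] := hatP tri zTh; case: ifPn => zK.
  rewrite -[rho^-1]mul1r; apply: slope_bound => // y yK.
  by rewrite hE ?(vertex_node KTh)// ger0_norm ?ler0n// lern1 leq_b1.
by rewrite (slope_hat tri zTh KTh) (negbTE zK) big1// => i _; rewrite mxE normr0.
Qed.

(** The barycentric coordinate of z drops from 1 to 0 along an edge of length at
    most h. *)
Lemma bary_slope_ge K z : K \in Th -> z \in K ->
  1 <= h * \sum_i `|(bary_affine K z).1 0 i|.
Proof.
move=> KTh zK; have ndK := cell_simplex tri KTh; have [cardK indK] := ndK.
have [w wK wz] : exists2 w, w \in K & w != z.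
  have : (0 < #|` (K `\ z)%fset|)%N by have := cardfsD1 z K; rewrite cardK zK add1n => -[<-].
  by rewrite cardfs_gt0 => /fset0Pn[w]; rewrite !inE => /andP[wz wK]; exists w.
have <- : inner (bary_affine K z).1 (z - w) = 1.
  have := bary_coord_vertex z indK zK; have := bary_coord_vertex z indK wK.
  by rewrite /bary_coord eqxx (negbTE wz) innerBr mulr0n mulr1n; lra.
apply: le_trans (ler_norm _) _; apply: inner_le_sum => i; rewrite !mxE.
by apply: le_trans (diam_mesh KTh); apply: hull_diam; exact: vertex_hull.
Qed.

(** The coordinate is nonnegative at the corner of the cube where it is smallest,
    hence at least rho times its slope at the centre, and half of that remains
    on the cube of half size. *)
Lemma bary_coord_ge K x : K \in Th ->
  (forall y, (forall i, `|y 0 i - x 0 i| <= rho) -> hull K y) ->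
  forall z y, z \in K -> cube x (rho / 2) y -> kappa / (2 * d%:R) <= bary_coord K z y.
Proof.
move=> KTh xK z y zK yx; have ndK := cell_simplex tri KTh.
set a := (bary_affine K z).1; set S := \sum_i `|a 0 i|.
have [s [srho as_]] := extremal_shift a (ltW rho_gt0); rewrite -/S in as_.
have : hull K (x - s).
  by apply: xK => i; rewrite !mxE addrAC subrr add0r normrN.
rewrite hullE//= => /(_ _ zK); rewrite /bary_coord -/a innerBr as_ => lamx.
have yxS : `|inner a (y - x)| <= rho / 2 * S.
  by apply: inner_le_sum => i; rewrite !mxE ltW// yx.
have hS : 1 <= h * S by exact: bary_slope_ge.
have kS : kappa / (2 * d%:R) <= rho / 2 * S.
  have -> : rho / 2 * S = kappa / (2 * d%:R) * (h * S).
    by rewrite /rho; field; rewrite gt_eqF.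
  by rewrite ler_peMr// divr_ge0 ?mulr_ge0// ltW.
move: yxS; rewrite innerBr ler_norml => /andP[yxS _]; lra.
Qed.

Lemma cube_center_interior K x :
  (forall y, (forall i, `|y 0 i - x 0 i| <= rho) -> hull K y) ->
  cube x (rho / 2) `<=` (hull K)°.
Proof.
move=> xK y yx; apply/nbhs_rowP; exists (rho / 2); first by rewrite divr_gt0.
move=> w wy; apply: xK => i; rewrite -(subrKA (y 0 i)) (le_trans (ler_normD _ _))//.
by rewrite (splitr rho) lerD// ltW.
Qed.

Let openO : open Omega. Proof. by case: polyO => -[]. Qed.
Let bndO : bounded_set Omega. Proof. by case: polyO => -[]. Qed.

Lemma hat_ge0 z x : z \in nodes Th -> Omega x -> 0 <= hat Omega Th z x.
Proof.
move=> zTh Ox; have [K KTh Kx] := closure_cell tri (@subset_closure _ _ x Ox).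
rewrite (hat_cell tri zTh KTh Kx); case: ifP => // zK.
by move: Kx; rewrite hullE; [apply|exact: (cell_simplex tri)].
Qed.

Lemma hat_integrable z : z \in nodes Th -> domain_integrable Omega (hat Omega Th z).
Proof.
move=> zTh; have [[hC _] _] := hatP tri zTh.
apply: (continuous_bounded_integrable openO bndO (M := 1)) => // x Ox.
have [K KTh Kx] := closure_cell tri (@subset_closure _ _ x Ox).
rewrite (hat_cell tri zTh KTh Kx); case: ifP => zK; last by rewrite normr0.
apply: hull_affine_le Kx _ => y yK; have [_ indK] := cell_simplex tri KTh.
by rewrite -/(bary_coord K z y) bary_coord_vertex// ger0_norm ?ler0n// lern1 leq_b1.
Qed.

(** On each cell at z the hat function is bounded below by a constant times the
    indicator of a cube, and these cubes are pairwise disjoint. *)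
Lemma beta_ge z : z \in nodes Th ->
  \sum_(K <- Th) (if z \in K then kappa / (2 * d%:R) * rho ^+ d else 0) <=
  beta Omega Th z.
Proof.
move=> zTh; have /choice[c cP] : forall K, exists x, K \in Th ->
    forall y, (forall i, `|y 0 i - x 0 i| <= rho) -> hull K y.
  move=> K; case: (boolP (K \in Th)) => [/inscribed_cube[x xK]|_]; last by exists 0.
  by exists x.
pose C K := cube (c K) (rho / 2).
have CK K : K \in Th -> C K `<=` (hull K)°.
  by move=> KTh; apply: cube_center_interior; exact: cP.
pose w K : R := if z \in K then kappa / (2 * d%:R) else 0.
have rho2 : 0 <= rho / 2 by rewrite ltW// divr_gt0.
have mC K : domain_integrable Omega \1_(C K).
  by apply: indic_integrable => //; exact: measurable_cube.
have disjC K K' x : K \in enum_fset Th -> K' \in enum_fset Th ->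
    C K x -> C K' x -> K = K'.
  move=> KTh K'Th /(CK _ KTh) Kx /(CK _ K'Th) K'x.
  exact: (cell_interiors_disjoint tri KTh K'Th Kx K'x).
have -> : \sum_(K <- Th) (if z \in K then kappa / (2 * d%:R) * rho ^+ d else 0) =
    integral_on Omega (fun x => \sum_(K <- Th) w K * \1_(C K) x).
  rewrite integral_on_sumZ//; apply: eq_big_seq => K KTh.
  rewrite integral_on_indic_cube//; last first.
    by move=> x /(CK _ KTh); exact: (cell_interior_domain polyO tri).
  have -> : 2 * (rho / 2) = rho by field.
  by rewrite /w; case: ifP => // _; rewrite mul0r.
apply: le_integral_on => //; [exact: integrable_sumZ|exact: hat_integrable|].
move=> x Ox; have [[K KTh Cx]|xout] := pselect (exists2 K, K \in Th & C K x).
  rewrite (sum_disjoint_in (fset_uniq Th) disjC w KTh Cx).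
  have Kx := interior_subset (CK _ KTh _ Cx).
  rewrite (hat_cell tri zTh KTh Kx) /w; case: ifP => // zK.
  by apply: bary_coord_ge Cx => //; exact: cP.
rewrite sum_disjoint_out ?hat_ge0// => K KTh Cx; apply: xout; by exists K.
Qed.

Let weight_gt0 : 0 < kappa / (2 * d%:R) * rho ^+ d.
Proof. by rewrite mulr_gt0 ?exprn_gt0// divr_gt0// mulr_gt0. Qed.

Lemma beta_gt0 z : z \in nodes Th -> 0 < beta Omega Th z.
Proof.
move=> zTh; apply: lt_le_trans (beta_ge zTh).
have /nodeP[K KTh zK] := zTh.
rewrite (bigD1_seq K) ?fset_uniq//= zK ltr_pwDl//.
by apply: sumr_ge0 => L _; case: ifP => // _; exact: ltW.
Qed.

Lemma cell_volume_le K : K \in Th -> cell_volume Omega K <= (4 * h) ^+ d.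
Proof.
move=> KTh; have ndK := cell_simplex tri KTh; have [cardK indK] := ndK.
have /fset0Pn[z zK] : K != fset0 by rewrite -cardfs_gt0 cardK.
have -> : 4 * h = 2 * (2 * h) by ring.
apply: (integral_on_indic_le openO bndO (c := z)).
- exact: measurable_cell.
- by rewrite mulr_ge0// ltW.
move=> x /interior_subset Kx i.
apply: (@le_lt_trans _ _ h); last by rewrite mulr_natl mulr2n ltrDl.
by apply: le_trans (diam_mesh KTh); apply: hull_diam => //; exact: vertex_hull.
Qed.

(** Ratio of the stiffness bound (4 h)^d / rho^2 of a cell to its mass bound
    kappa / (2 d) rho^d, times h^2. *)
Definition lap_const (d : nat) (kappa : R) : R :=
  (4 * d%:R / kappa) ^+ d * (d%:R / kappa) ^+ 2 * (2 * d%:R / kappa).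

(** Stiffness and mass are compared cell by cell, which avoids counting the cells
    that share a node. *)
Lemma lap_bound u (M : R) z : z \in nodes Th ->
  (forall y, y \in nodes Th -> `|u y| <= M) ->
  `|lap Omega Th u z| <= lap_const d kappa / h ^+ 2 * M.
Proof.
move=> zTh uM; have M0 : 0 <= M by exact: le_trans (uM z zTh).
rewrite /lap normrM normfV (gtr0_norm (beta_gt0 zTh)) ler_pdivrMr ?beta_gt0//.
apply: (@le_trans _ _ (lap_const d kappa / h ^+ 2 * M *
  \sum_(K <- Th) (if z \in K then kappa / (2 * d%:R) * rho ^+ d else 0))); last first.
  rewrite ler_wpM2l ?beta_ge// mulr_ge0// divr_ge0 ?sqr_ge0//.
  by rewrite !mulr_ge0 ?exprn_ge0 ?invr_ge0 ?mulr_ge0 ?invr_ge0// ltW.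
rewrite mulr_sumr /stiff (le_trans (ler_norm_sum _ _ _))// big_seq [leRHS]big_seq.
apply: ler_sum => K KTh.
rewrite normrM (ger0_norm (cell_volume_ge0 _ _)).
have vol := cell_volume_le KTh.
have uK : \sum_i `|slope K u 0 i| <= M / rho.
  by apply: slope_bound => // y yK; rewrite uM// (vertex_node KTh).
have hK := hat_slope_bound KTh zTh.
have entry (a : 'rV[R]_d) i : `|a 0 i| <= \sum_j `|a 0 j|.
  by rewrite (bigD1 i)//= lerDl sumr_ge0.
have innerK : `|inner (slope K u) (slope K (hat Omega Th z))| <=
    (if z \in K then rho^-1 else 0) * (M / rho).
  apply: (le_trans (inner_le_sum _ (entry _))).
  by apply: ler_pM => //; apply: sumr_ge0.
apply: (le_trans (ler_pM (normr_ge0 _) (cell_volume_ge0 _ _) innerK vol)).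
case: ifP => _; last by rewrite !mul0r mulr0.
rewrite le_eqVlt; apply/orP; left; apply/eqP.
have -> : 4 * h = 4 * d%:R / kappa * rho.
  by rewrite /rho; field; rewrite !gt_eqF.
rewrite /lap_const [(_ * rho) ^+ d]exprMn; set E := (_ / kappa) ^+ d.
set P := rho ^+ d; rewrite /rho; field.
by rewrite !gt_eqF.
Qed.

End quasiuniform_bounds.

(** * Existence of one time step *)

Section time_step.
Context {R : realType} {d : nat}.
Variables (Omega : set 'rV[R]_d) (Th : {fset {fset 'rV[R]_d}}).
Hypothesis polyO : polyhedral_domain Omega.
Hypothesis tri : triangulation Omega Th.
Hypothesis beta0 : forall z, z \in nodes Th -> 0 < beta Omega Th z.
Local Notation field := ('rV[R]_d -> 'rV[R]_3).
Implicit Types (U P X Y : field) (z : 'rV[R]_d).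

Lemma Vh_lin (a b : R) (u v : 'rV[R]_d -> R) : Vh Omega Th u -> Vh Omega Th v ->
  Vh Omega Th (fun x => a * u x + b * v x).
Proof.
move=> [cu uA] [cv vA]; split.
  move=> x; have cux := cu x; have cvx := cv x.
  exact: (cvgD (cvgM (cvg_cst a) cux) (cvgM (cvg_cst b) cvx)).
move=> K KTh; have [au [bu uE]] := uA K KTh; have [av [bv vE]] := vA K KTh.
exists (a *: au + b *: av), (a * bu + b * bv) => x Kx.
by rewrite uE// vE// innerDl !innerZl; ring.
Qed.

Lemma eq_Vh (u v : 'rV[R]_d -> R) : u = v -> Vh Omega Th u -> Vh Omega Th v.
Proof. by move=> ->. Qed.

Lemma VVh_lin (a b : R) U P : VVh Omega Th U -> VVh Omega Th P ->
  VVh Omega Th (fun x => a *: U x + b *: P x).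
Proof.
move=> UV PV k; apply: eq_Vh (Vh_lin a b (UV k) (PV k)).
by apply/funext => x; rewrite !mxE.
Qed.

Definition vlap U z : 'rV[R]_3 := \row_k lap Omega Th (fun y => U y 0 k) z.

Lemma vlap_lin (a b : R) U P z :
  vlap (fun x => a *: U x + b *: P x) z = a *: vlap U z + b *: vlap P z.
Proof.
apply/rowP => k; rewrite !mxE -lap_lin; congr lap.
by apply/funext => y; rewrite !mxE.
Qed.

Lemma eq_vlap U P z :
  (forall y, y \in nodes Th -> U y = P y) -> vlap U z = vlap P z.
Proof. by move=> UP; apply/rowP => k; rewrite !mxE; apply: eq_lap => y /UP ->. Qed.

Lemma vlap0 z : vlap (fun=> 0) z = 0.
Proof. by have := vlap_lin 0 0 (fun=> 0) (fun=> 0) z; rewrite !scale0r !addr0. Qed.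

Lemma hprod_vlap U P : hprod Omega Th (vlap U) P =
  \sum_k stiff Omega Th (fun y => U y 0 k) (fun y => P y 0 k).
Proof.
under [RHS]eq_bigr do rewrite -(hprod_lap tri beta0).
rewrite exchange_big; apply: eq_bigr => z _ /=; rewrite -mulr_sumr; congr (_ * _).
by rewrite inner_rowE; apply: eq_bigr => k _; rewrite mxE.
Qed.

Lemma hprodC U P : hprod Omega Th U P = hprod Omega Th P U.
Proof. by apply: eq_bigr => z _; rewrite innerC. Qed.

(** Both sides are the Dirichlet form of the nodal interpolants. *)
Lemma hprod_vlapC U P : hprod Omega Th (vlap U) P = hprod Omega Th U (vlap P).
Proof.
rewrite hprod_vlap hprodC hprod_vlap; apply: eq_bigr => k _; exact: stiffC.
Qed.

Lemma eq_hprod U U' P P' :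
  (forall z, z \in nodes Th -> inner (U z) (P z) = inner (U' z) (P' z)) ->
  hprod Omega Th U P = hprod Omega Th U' P'.
Proof. by move=> UP; apply: eq_big_seq => z zTh; rewrite UP. Qed.

Lemma dlaplaceP U : VVh Omega Th U -> VVh Omega Th (dlaplace Omega Th U) /\
  forall z, z \in nodes Th -> dlaplace Omega Th U z = - vlap U z.
Proof.
move=> UV; split=> [k|z zTh].
  apply: eq_Vh (dlaplace_scalarP polyO tri beta0 (UV k)).1.
  by apply/funext => x; rewrite mxE.
apply/rowP => k; rewrite !mxE.
by rewrite (dlaplace_scalarP polyO tri beta0 (UV k)).2.
Qed.

Section one_step.
Variables (tau c : R).
Hypothesis tau_gt0 : 0 < tau.
Hypothesis c0 : 0 <= c.
Hypothesis lap_le : forall (u : 'rV[R]_d -> R) (M : R) z, z \in nodes Th ->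
  (forall y, y \in nodes Th -> `|u y| <= M) -> `|lap Omega Th u z| <= c * M.
Hypothesis tauc : tau * c <= 12^-1.

Lemma vlap_lipschitz X Y (e : R) :
  (forall z k, z \in nodes Th -> `|X z 0 k - Y z 0 k| <= e) ->
  forall z k, z \in nodes Th -> `|vlap X z 0 k - vlap Y z 0 k| <= c * e.
Proof.
move=> XY z k zTh; rewrite !mxE.
have -> : lap Omega Th (fun y => X y 0 k) z - lap Omega Th (fun y => Y y 0 k) z =
    lap Omega Th (fun y => 1 * X y 0 k + (-1) * Y y 0 k) z by rewrite lap_lin; ring.
by apply: lap_le => // y yTh; rewrite mul1r mulN1r XY.
Qed.

(** The invariant 0 <= <b - a, b> is what keeps <b, b + (b - a) / 2> >= 1; it is
    reproduced since <b' - b, b'> = |b' - b|^2 / 2 for unit vectors. *)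
Lemma step_exists (a b : field) :
  (forall z, z \in nodes Th -> inner (b z) (b z) = 1 /\ 0 <= inner (b z - a z) (b z)) ->
  exists b' : field, VVh Omega Th b' /\ forall z, z \in nodes Th ->
    [/\ inner (b' z) (b' z) = 1, 0 <= inner (b' z - b z) (b' z), b' z + b z != 0 &
      exists nu : R, tau^-1 *: (tau^-1 *: (b' z - b z) - tau^-1 *: (b z - a z)) +
        vlap (vlap (fun x => 2^-1 *: (b' x + b x))) z = nu *: (2^-1 *: (b' z + b z))].
Proof.
move=> ab.
pose B X z := (tau ^+ 2 / 2) *: vlap (vlap X) z.
pose p z := b z + 2^-1 *: (b z - a z).
have [||z zTh|z zTh|X XP] := @nodal_fixed_point R _ (enum_fset (nodes Th)) B b p.
- move=> X Y e e0 XY z k zTh.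
  have := vlap_lipschitz (vlap_lipschitz XY) k zTh.
  set D := vlap _ z 0 k - _; move=> D_le.
  have -> : B X z 0 k - B Y z 0 k = tau ^+ 2 / 2 * D by rewrite /B mxE [X in _ - X]mxE -mulrBr.
  rewrite normrM ger0_norm ?divr_ge0 ?sqr_ge0//.
  apply: (@le_trans _ _ (tau ^+ 2 / 2 * (c * (c * e)))).
    by rewrite ler_wpM2l ?divr_ge0 ?sqr_ge0.
  have -> : tau ^+ 2 / 2 * (c * (c * e)) = (tau * c) ^+ 2 * (e / 2) by field.
  have -> : e / 288 = 12^-1 ^+ 2 * (e / 2) by field.
  by rewrite ler_wpM2r ?divr_ge0// ler_pXn2r// nnegrE ?mulr_ge0// ltW.
- move=> z zTh; rewrite /B (@eq_vlap _ (fun=> 0)) => [|y _]; last exact: vlap0.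
  by rewrite vlap0 scaler0.
- by have [] := ab z zTh.
- by have [b1 ba] := ab z zTh; rewrite /p innerDr innerZr b1 innerC; lra.
pose b' : field := fun x => \row_k interpolant Th (fun z => (2 *: X z - b z) 0 k) x.
exists b'; split.
  move=> k; apply: eq_Vh (interpolant_Vh tri (fun z => (2 *: X z - b z) 0 k)).
  by apply/funext => x; rewrite mxE.
move=> z zTh; have [b1 ba] := ab z zTh.
have b'E y : y \in nodes Th -> b' y = 2 *: X y - b y.
  by move=> yTh; apply/rowP => k; rewrite mxE (interpolant_node tri).
have midE y : y \in nodes Th -> 2^-1 *: (b' y + b y) = X y.
  by move=> yTh; rewrite b'E// subrK scalerA mulVf ?scale1r.
have [qb XE] := XP z zTh; set q := p z - B X z in qb XE.
have q0 : q != 0 by apply: contraTneq qb => ->; rewrite inner0r -ltNge; lra.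
have XX : inner (X z) (X z) = inner (X z) (b z).
  by rewrite XE; exact: line_proj_self.
have qq : inner q q != 0 by rewrite inner_eq0.
have bq : inner (b z) q != 0 by apply: contraTneq qb => ->; rewrite -ltNge; lra.
have X0 : X z != 0 by rewrite XE /line_proj scaler_eq0 negb_or q0 andbT mulf_neq0 ?invr_neq0.
have b'1 : inner (b' z) (b' z) = 1.
  rewrite b'E// !innerBl !innerBr !innerZl !innerZr b1 (innerC (b z)) XX; ring.
split=> //.
- have := inner_ge0 (b' z - b z); rewrite !innerBl !innerBr b'1 b1 (innerC (b' z)); lra.
- by rewrite b'E// subrK scaler_eq0 negb_or X0 andbT.
exists (2 / tau ^+ 2 * (1 - inner q q / inner (b z) q)); rewrite midE//.
have -> : vlap (vlap (fun x => 2^-1 *: (b' x + b x))) z = vlap (vlap X) z.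
  by apply: eq_vlap => y yTh; apply: eq_vlap => w; exact: midE.
have BE : vlap (vlap X) z = (2 / tau ^+ 2) *: (p z - q).
  rewrite /q opprB addrCA subrr addr0 /B scalerA (_ : _ * _ = 1) ?scale1r//.
  by field; rewrite gt_eqF.
have qE : (inner q q / inner (b z) q) *: X z = q.
  by rewrite XE /line_proj scalerA (_ : _ * _ = 1) ?scale1r//; field; rewrite qq bq.
rewrite BE b'E// -[RHS]scalerA scalerBl scale1r qE /p.
by apply/rowP => k; rewrite !mxE; field; rewrite gt_eqF.
Qed.

End one_step.

End time_step.

(** * Trajectories satisfy the scheme and conserve energy *)

Section trajectory.
Context {R : realType} {d : nat}.
Variables (Omega : set 'rV[R]_d) (Th : {fset {fset 'rV[R]_d}}).
Hypothesis polyO : polyhedral_domain Omega.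
Hypothesis tri : triangulation Omega Th.
Hypothesis beta0 : forall z, z \in nodes Th -> 0 < beta Omega Th z.
Local Notation field := ('rV[R]_d -> 'rV[R]_3).
Local Notation vlap := (vlap Omega Th).
Variables (tau : R) (U0 V0 : field) (U : int -> field).
Hypothesis tau_gt0 : 0 < tau.
Hypothesis U_init : U 0 = U0.
Hypothesis U_pre : U (- 1) = (fun x => U0 x - tau *: V0 x).
Hypothesis orth0 : forall z, z \in nodes Th -> inner (U0 z) (V0 z) = 0.
Hypothesis U_VVh : forall n : nat, VVh Omega Th (U n).
Hypothesis U_unit : forall (n : nat) z, z \in nodes Th -> inner (U n z) (U n z) = 1.
Hypothesis mid_neq0 : forall (n : nat) z, z \in nodes Th -> mid U n z != 0.
Hypothesis U_step : forall (n : nat) z, z \in nodes Th -> exists nu : R,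
  dt tau (dt tau U) (n%:Z + 1) z + vlap (vlap (mid U n)) z = nu *: mid U n z.

Let tau0 : tau != 0. Proof. by rewrite gt_eqF. Qed.

Let nat_succ (n : nat) : n%:Z + 1 = n.+1. Proof. by rewrite -addn1. Qed.

Let Wseq (k : int) : field := fun x => - dlaplace Omega Th (U k) x.

Let lamseq (k : int) : 'rV[R]_d -> R :=
  interpolant Th (multiplier Omega Th tau V0 U Wseq (k - 1)).

(** The fictitious iterate of index -1 makes the initial velocity a backward
    difference like the others. *)
Lemma velocityE (n : nat) z : velocity tau V0 U n z = dt tau U n z.
Proof.
rewrite /velocity; case: n => [|n] //=.
rewrite /dt sub0r U_init U_pre opprB addrC subrK scalerA mulVf// scale1r//.
Qed.

Let WseqE (n : nat) z : z \in nodes Th -> Wseq n z = vlap (U n) z.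
Proof. by move=> zTh; rewrite /Wseq (dlaplaceP polyO tri beta0 (U_VVh n)).2// opprK. Qed.

Let W_VVh (n : nat) : VVh Omega Th (Wseq n).
Proof.
have [DV _] := dlaplaceP polyO tri beta0 (U_VVh n).
move=> k; apply: eq_Vh (VVh_lin (- 1) 0 DV DV k).
by apply/funext => x; rewrite scaleN1r scale0r addr0.
Qed.

Let mid_VVh (S : int -> field) (n : nat) : VVh Omega Th (S n) ->
  VVh Omega Th (S n.+1) -> VVh Omega Th (mid S n).
Proof.
move=> Sn Sn1 k; apply: eq_Vh (VVh_lin 2^-1 2^-1 Sn1 Sn k).
by apply/funext => x; rewrite /mid nat_succ scalerDr.
Qed.

Let mid_vlap (n : nat) z : z \in nodes Th -> mid Wseq n z = vlap (mid U n) z.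
Proof.
move=> zTh; rewrite /mid nat_succ !WseqE// scalerDr -vlap_lin.
by apply: eq_vlap => y _; rewrite scalerDr.
Qed.

Let diff_mid (n : nat) z : z \in nodes Th -> inner (U (n%:Z + 1) z - U n z) (mid U n z) = 0.
Proof.
move=> zTh; rewrite /mid nat_succ innerZr !innerBl !innerDr !U_unit//.
by rewrite (innerC (U n z) (U n.+1 z)); ring.
Qed.

Lemma second_difference_dot (n : nat) z : z \in nodes Th ->
  inner (dt tau (dt tau U) (n%:Z + 1) z) (mid U n z) =
  - (tau^-1 * inner (dt tau U n z) (mid U n z)).
Proof.
move=> zTh; rewrite {1}/dt addrK innerZl innerBl {1}/dt addrK innerZl diff_mid//; ring.
Qed.

(** U^0 is orthogonal to V^0, so only the increment of the midpoint counts. *)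
Lemma first_step_dot z : z \in nodes Th ->
  tau^-1 * inner (dt tau U 0 z) (mid U 0 z) =
  2^-1 * inner (V0 z) (velocity tau V0 U 1 z).
Proof.
move=> zTh; rewrite -(velocityE 0 z).
have -> : velocity tau V0 U 1 z = tau^-1 *: (U 1 z - U0 z) by rewrite -U_init.
rewrite /velocity /= /mid add0r U_init !innerZr innerDr innerBr.
by rewrite (innerC (V0 z) (U0 z)) orth0//; ring.
Qed.

(** d_t U^(n+1) is orthogonal to the previous midpoint, because both of its
    endpoints have norm 1; it can be subtracted for free. *)
Lemma later_step_dot (n : nat) z : z \in nodes Th ->
  tau^-1 * inner (dt tau U n.+1 z) (mid U n.+1 z) =
  inner (dt tau U n.+1 z) (dt tau (mid U) n.+1 z).
Proof.
move=> zTh.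
have -> : dt tau (mid U) n.+1 z = tau^-1 *: (mid U n.+1 z - mid U n z).
  by rewrite /dt -nat_succ addrK.
have : inner (dt tau U n.+1 z) (mid U n z) = 0.
  by rewrite -nat_succ /dt addrK innerZl diff_mid// mulr0.
move: (dt tau U n.+1 z) (mid U n.+1 z) (mid U n z) => v X Y vY.
by rewrite innerZr innerBr vY subr0.
Qed.

(** Collinearity determines the multiplier: pair with the midpoint. *)
Lemma multiplierE (n : nat) z : z \in nodes Th ->
  dt tau (dt tau U) (n%:Z + 1) z + vlap (vlap (mid U n)) z =
  multiplier Omega Th tau V0 U Wseq n z *: mid U n z.
Proof.
move=> zTh; have [nu nuE] := U_step n zTh; rewrite nuE; congr (_ *: _).
have X0 := mid_neq0 n zTh; set X := mid U n z in nuE X0 *.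
have XX : inner X X != 0 by rewrite inner_eq0.
have nuXX : nu = (inner (dt tau (dt tau U) (n%:Z + 1) z) X +
    inner (vlap (vlap (mid U n)) z) X) / inner X X.
  by rewrite -innerDl nuE innerZl mulfK.
rewrite nuXX /multiplier -/X (negbTE X0) sqr_enorm mulrDl; congr (_ / _ + _).
  rewrite second_difference_dot// /X; case: (n) => [|m] /=.
    by rewrite first_step_dot.
  by rewrite later_step_dot.
rewrite (L2inner_vgrad_hat polyO tri)//; last by apply: mid_VVh; exact: W_VVh.
rewrite [inner (vlap _ _) _]innerC inner_rowE.
have b0 : beta Omega Th z != 0 by rewrite gt_eqF// beta0.
have -> : \sum_k X 0 k * stiff Omega Th (fun y => mid Wseq n y 0 k) (hat Omega Th z) =
    beta Omega Th z * \sum_k X 0 k * vlap (vlap (mid U n)) z 0 k.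
  rewrite mulr_sumr; apply: eq_bigr => k _; rewrite mulrCA; congr (_ * _).
  rewrite -(beta_lap beta0 (fun y => mid Wseq n y 0 k) zTh) mxE; congr (_ * _).
  by apply: eq_lap => y yTh; rewrite mid_vlap.
by rewrite -mulf_div divff// mul1r.
Qed.

Lemma L2inner_vlap (P Q : field) : VVh Omega Th P -> VVh Omega Th Q ->
  L2inner Omega (vgrad Th P) (vgrad Th Q) = hprod Omega Th (vlap P) Q.
Proof. by move=> PV QV; rewrite (L2inner_vgrad polyO tri)// hprod_vlap. Qed.

Lemma trajectory_scheme (n : nat) : scheme_step Omega Th tau V0 U Wseq lamseq n.
Proof.
have midUV : VVh Omega Th (mid U n) by apply: mid_VVh.
have midWV : VVh Omega Th (mid Wseq n) by apply: mid_VVh; exact: W_VVh.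
have lamE z : z \in nodes Th ->
    lamseq (n%:Z + 1) z = multiplier Omega Th tau V0 U Wseq n z.
  by move=> zTh; rewrite /lamseq (interpolant_node tri)// addrK.
split.
- by rewrite nat_succ.
- by rewrite nat_succ; exact: W_VVh.
- by split; [exact: (interpolant_Vh tri)|exact: lamE].
- move=> Phi PhiV; rewrite L2inner_vlap// /hprod -big_split.
  apply: eq_big_seq => z zTh /=; rewrite -mulrDr -innerDl lamE// -multiplierE//.
  by congr (_ * inner (_ + _) _); apply: eq_vlap => y yTh; exact: mid_vlap.
- move=> Psi PsiV; rewrite L2inner_vlap//.
  by apply: eq_hprod => z zTh; rewrite mid_vlap.
Qed.

Lemma weighted_sum3 (a b c : R) (f g k : 'rV[R]_d -> R) :
  a * (\sum_(z <- nodes Th) beta Omega Th z * f z) +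
  b * (\sum_(z <- nodes Th) beta Omega Th z * g z) +
  c * (\sum_(z <- nodes Th) beta Omega Th z * k z) =
  \sum_(z <- nodes Th) beta Omega Th z * (a * f z + b * g z + c * k z).
Proof.
rewrite 3!mulr_sumr -2!big_split; apply: eq_bigr => z _ /=; ring.
Qed.

(** The difference of the two sides is, node by node, the integrand of
    (A X, A D)_h - (A (A X), D)_h with D = U^(n+1) - U^n, which vanishes by
    symmetry of A; the multiplier disappears since X is orthogonal to D. *)
Lemma energy_step (n : nat) :
  energy Omega Th (velocity tau V0 U n.+1) (U n.+1) +
  tau ^+ 2 / 2 * hprod Omega Th (dt tau (velocity tau V0 U) n.+1)
                                (dt tau (velocity tau V0 U) n.+1) =
  energy Omega Th (velocity tau V0 U n) (U n).
Proof.
pose D : field := fun x => 1 *: U n.+1 x + (- 1) *: U n x.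
have sym : hprod Omega Th (vlap (mid U n)) (vlap D) =
    hprod Omega Th (vlap (vlap (mid U n))) D by rewrite [RHS](hprod_vlapC tri beta0).
have -> : energy Omega Th (velocity tau V0 U n) (U n) =
    energy Omega Th (velocity tau V0 U n) (U n) +
    (1 * hprod Omega Th (vlap (mid U n)) (vlap D) +
     (-1) * hprod Omega Th (vlap (vlap (mid U n))) D + 0 * hprod Omega Th D D).
  by rewrite sym; ring.
(* The null terms bring all three expressions to the shape of weighted_sum3. *)
have e0 (e : R) : e = e + 0 * hprod Omega Th D D by rewrite mul0r addr0.
pose hf (P Q : field) z := inner (P z) (Q z).
pose dlap k := dlaplace Omega Th (U k).
pose vel := velocity tau V0 U; pose acc := dt tau vel.
have E1 := weighted_sum3 2^-1 2^-1 (tau ^+ 2 / 2) (hf (vel n.+1) (vel n.+1))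
  (hf (dlap n.+1) (dlap n.+1)) (hf (acc n.+1) (acc n.+1)).
have E2 : energy Omega Th (vel n) (U n) = _ := etrans (e0 (energy Omega Th (vel n) (U n)))
  (weighted_sum3 2^-1 2^-1 0 (hf (vel n) (vel n)) (hf (dlap n) (dlap n)) (hf D D)).
have E3 : 1 * hprod Omega Th (vlap (mid U n)) (vlap D) +
     (-1) * hprod Omega Th (vlap (vlap (mid U n))) D + 0 * hprod Omega Th D D = _ :=
  weighted_sum3 1 (-1) 0 (hf (vlap (mid U n)) (vlap D))
    (hf (vlap (vlap (mid U n))) D) (hf D D).
apply: (etrans E1); apply: esym; rewrite E2 E3.
rewrite -big_split.
apply: eq_big_seq => z zTh /=; rewrite -mulrDr; congr (_ * _); apply: esym.
rewrite /hf /dlap /acc /vel.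
have dE (m : nat) : dlaplace Omega Th (U m) z = - vlap (U m) z.
  by rewrite (dlaplaceP polyO tri beta0 (U_VVh m)).2.
rewrite !dE !innerNl !innerNr !opprK.
have [nu nuE] := U_step n zTh.
have A2E : vlap (vlap (mid U n)) z = nu *: mid U n z - dt tau (dt tau U) (n%:Z + 1) z.
  by rewrite -nuE addrC addKr.
have aE : vlap (mid U n) z = 2^-1 *: (vlap (U n.+1) z + vlap (U n) z).
  rewrite scalerDr -vlap_lin; apply: eq_vlap => y _.
  by rewrite /mid nat_succ scalerDr.
have DE : vlap D z = vlap (U n.+1) z - vlap (U n) z.
  by rewrite /D vlap_lin scale1r scaleN1r.
have XD : inner (mid U n z) (D z) = 0.
  by rewrite innerC /D scale1r scaleN1r -nat_succ diff_mid.
have DzE : D z = tau *: velocity tau V0 U n.+1 z.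
  rewrite velocityE /dt -nat_succ addrK scalerA divff// scale1r /D nat_succ.
  by rewrite !scale1r scaleN1r.
have ddE : dt tau (dt tau U) (n%:Z + 1) z =
    tau^-1 *: (velocity tau V0 U n.+1 z - velocity tau V0 U n z).
  by rewrite {1}/dt addrK !velocityE -nat_succ.
have dvE : dt tau (velocity tau V0 U) n.+1 z =
    tau^-1 *: (velocity tau V0 U n.+1 z - velocity tau V0 U n z).
  by rewrite {1}/dt -nat_succ addrK.
rewrite A2E innerBl innerZl XD aE DE ddE dvE DzE.
move: (velocity tau V0 U n.+1 z) (velocity tau V0 U n z) => v' v.
move: (vlap (U n.+1) z) (vlap (U n) z) => a' a.
rewrite !innerZl !innerZr !innerBl !innerBr !innerDl.
rewrite (innerC v v') (innerC a a').
by field.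
Qed.

End trajectory.

(** * Existence, constraint and energy identity *)

Theorem lemma3p1 (R : realType) (d : nat) (Omega : set 'rV[R]_d) (kappa : R) :
  (0 < d <= 3)%N -> polyhedral_domain Omega -> 0 < kappa ->
  exists2 Ctilde : R, 0 < Ctilde &
  forall (Th : {fset {fset 'rV[R]_d}}) (T : R) (N : nat)
    (U0 V0 : 'rV[R]_d -> 'rV[R]_3) (tau := T / N%:R),
  triangulation Omega Th -> quasiuniform kappa Th ->
  0 < T -> (0 < N)%N -> tau <= Ctilde * mesh_size Th ^+ 2 ->
  VVh Omega Th U0 -> VVh Omega Th V0 ->
  (forall z, z \in nodes Th -> enorm (U0 z) = 1 /\ inner (U0 z) (V0 z) = 0) ->
  exists (U W : int -> 'rV[R]_d -> 'rV[R]_3) (lam : int -> 'rV[R]_d -> R),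
  [/\ solves_scheme Omega Th tau N U0 V0 U W lam,
      forall n : nat, (n < N)%N ->
        forall z, z \in nodes Th -> enorm (U n.+1 z) = 1 &
      forall m : nat, (1 <= m <= N)%N ->
        energy Omega Th (velocity tau V0 U m) (U m) +
          tau ^+ 2 / 2 * \sum_(1 <= n < m.+1)
            hprod Omega Th (dt tau (velocity tau V0 U) n)
                           (dt tau (velocity tau V0 U) n)
        = energy Omega Th V0 U0].
Proof.
move=> /andP[d_gt0 _] polyO kappa_gt0.
have dR : (0 : R) < d%:R by rewrite ltr0n.
have L_gt0 : 0 < lap_const d kappa.
  by rewrite /lap_const; do ?[apply: exprn_gt0 | apply: mulr_gt0 | rewrite invr_gt0 | by []].
exists (12 * lap_const d kappa)^-1; first by rewrite invr_gt0 mulr_gt0.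
move=> Th T N U0 V0 tau tri quasi T_gt0 N_gt0 tau_le U0V V0V init.
have tau_gt0 : 0 < tau by rewrite divr_gt0// ltr0n.
have h_gt0 : 0 < mesh_size Th.
  rewrite lt_neqAle; apply/andP; split; last exact: bigmax_ge_id.
  apply: contraTneq tau_le => <-; rewrite expr0n mulr0 -ltNge//.
have beta0 := beta_gt0 d_gt0 kappa_gt0 polyO tri quasi h_gt0.
pose c := lap_const d kappa / mesh_size Th ^+ 2.
have tauc : tau * c <= 12^-1.
  rewrite /c mulrA ler_pdivrMr ?exprn_gt0// -ler_pdivlMr//.
  apply: (le_trans tau_le); rewrite le_eqVlt; apply/orP; left; apply/eqP.
  by field; rewrite gt_eqF.
(* Pairs of consecutive iterates; ok is the invariant that allows a step. *)
pose field := ('rV[R]_d -> 'rV[R]_3)%type.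
pose ok (ab : field * field) := forall z, z \in nodes Th ->
  inner (ab.2 z) (ab.2 z) = 1 /\ 0 <= inner (ab.2 z - ab.1 z) (ab.2 z).
pose next_of (ab : field * field) (b' : field) := VVh Omega Th b' /\
  forall z, z \in nodes Th ->
    [/\ inner (b' z) (b' z) = 1, 0 <= inner (b' z - ab.2 z) (b' z),
      b' z + ab.2 z != 0 &
      exists nu : R, tau^-1 *: (tau^-1 *: (b' z - ab.2 z) - tau^-1 *: (ab.2 z - ab.1 z)) +
        vlap Omega Th (vlap Omega Th (fun x => 2^-1 *: (b' x + ab.2 x))) z =
        nu *: (2^-1 *: (b' z + ab.2 z))].
have /choice[next nextP] : forall ab, exists b', ok ab -> next_of ab b'.
  move=> [a b]; have [okab|nok] := pselect (ok (a, b)); last by exists b => /nok.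
  have c0 : 0 <= c by rewrite divr_ge0 ?sqr_ge0// ltW.
  have [|b' b'P] := step_exists tri tau_gt0 c0 _ tauc okab.
    exact: (lap_bound d_gt0 kappa_gt0 polyO tri quasi h_gt0).
  by exists b'.
pose pre : field := fun x => U0 x - tau *: V0 x.
pose st (n : nat) := iter n (fun ab => (ab.2, next ab)) (pre, U0).
have okst n : ok (st n).
  elim: n => [|n IH] z zTh /=.
    have [/enorm_eq1 u1 uv] := init z zTh; split=> //.
    by rewrite /pre opprB addrC subrK innerZl innerC uv mulr0.
  by have [_ /(_ z zTh)[]] := nextP _ IH.
pose U (k : int) : field := if k is Posz n then (st n).2 else pre.
have predE (n : nat) : U (n%:Z - 1) = (st n).1.
  case: n => [//|n]; have -> : n.+1%:Z - 1 = n%:Z by rewrite -addn1 PoszD addrK.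
  by [].
have UV (n : nat) : VVh Omega Th (U n).
  by case: n => [//|n]; have [] := nextP _ (okst n).
have succE (n : nat) : n%:Z + 1 = n.+1 by rewrite -addn1.
have stepP n z : z \in nodes Th -> _ := fun zTh => (nextP _ (okst n)).2 z zTh.
have Uunit (n : nat) z : z \in nodes Th -> inner (U n z) (U n z) = 1.
  by move=> zTh; have [] := okst n z zTh.
have mid0 (n : nat) z : z \in nodes Th -> mid U n z != 0.
  move=> /(stepP n)[_ _ nz _]; rewrite /mid succE scaler_eq0 negb_or nz andbT.
  by rewrite invr_eq0.
have Ustep (n : nat) z : z \in nodes Th -> exists nu : R,
  dt tau (dt tau U) (n%:Z + 1) z + vlap Omega Th (vlap Omega Th (mid U n)) z =
  nu *: mid U n z.
  move=> /(stepP n)[_ _ _ [nu nuE]]; exists nu.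
  rewrite /mid succE -nuE /dt -succE addrK predE succE//.
have orth z : z \in nodes Th -> inner (U0 z) (V0 z) = 0 by move=> /init[].
have U_init : U 0 = U0 by [].
have U_pre : U (- 1) = pre by [].
pose W (k : int) : field := fun x => - dlaplace Omega Th (U k) x.
pose lam (k : int) := interpolant Th (multiplier Omega Th tau V0 U W (k - 1)).
exists U, W, lam; split.
- split => // n _.
  exact: (trajectory_scheme polyO tri beta0 tau_gt0 U_init U_pre orth UV Uunit mid0 Ustep).
- by move=> n _ z zTh; apply/enorm_eq1; exact: Uunit.
have enE := energy_step polyO tri beta0 tau_gt0 U_init U_pre UV Uunit Ustep.
move=> m _; elim: m => [|m IH].
  by rewrite big_geq// mulr0 addr0.
by rewrite big_nat_recr//= mulrDr [X in _ + X]addrC addrA enE.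
Qed.
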